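(* If $Z\in 2^\omega$ is almost everywhere dominating, then every set $R$ which is 1-$Z$-random is 2-random.
   Context: $\mu$ is the fair-coin (Lebesgue) probability measure on $2^\omega$; ''almost all'' means on a set of $\mu$-measure $1$. A Martin-Löf test relative to a set $A$ is a sequence $\langle U_n:n\in\omega\rangle$ of $\Sigma^{0,A}_1$ classes in $2^\omega$, uniform in $A$, with $\mu(U_n)\leq 2^{-n}$ for each $n$. A set $R$ is 1-$A$-random if for every Martin-Löf test $\langle U_n\rangle$ relative to $A$, $R\notin\bigcap_n U_n$; $R$ is 2-random if it is 1-$0'$-random. For $f,g\in\omega^\omega$, $f$ dominates $g$ if $\exists m\,\forall n>m\,(f(n)>g(n))$. A set $A$ is almost everywhere (a.e.) dominating if for almost all $X\in 2^\omega$ and all functions $g\leq_T X$, there is a function $f\leq_T A$ such that $f$ dominates $g$. *)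

(* Defs.v *)
From HB Require Import structures.
From mathcomp Require Import all_boot all_order all_algebra.
From mathcomp Require Import all_classical all_reals all_analysis.
From mathcomp Require Import zify lra.
From Stdlib Require Cantor.

Set Implicit Arguments.
Unset Strict Implicit.
Unset Printing Implicit Defensive.

Import Order.TTheory GRing.Theory Num.Theory.

Local Open Scope classical_set_scope.
Local Open Scope ring_scope.

Definition pairn (x y : nat) : nat := Cantor.to_nat (x, y).

(* Indices of partial recursive functions with an oracle.  All functions are
   unary; several arguments are packed with [pairn]. *)
Inductive code : Type :=
| Zero | Succ | Fst | Snd
| Query
| Pair of code & code
| Comp of code & code
| Prec of code & code
| Mu of code.

(* [eval A c n m]: the computation of c with oracle A on input n halts with
   output m. *)
Fixpoint eval (A : nat -> bool) (c : code) : nat -> nat -> Prop :=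
  match c with
  | Zero => fun _ m => m = 0%N
  | Succ => fun n m => m = n.+1
  | Fst => fun n m => m = (Cantor.of_nat n).1
  | Snd => fun n m => m = (Cantor.of_nat n).2
  | Query => fun n m => m = A n
  | Pair c d => fun n m =>
      exists x y, [/\ eval A c n x, eval A d n y & m = pairn x y]
  | Comp c d => fun n m => exists2 x, eval A d n x & eval A c x m
  (* h(a,0) = c(a) and h(a,k+1) = d(a,(k,h(a,k))) *)
  | Prec c d => fun n m =>
      let a := (Cantor.of_nat n).1 in
      (fix iter (k m : nat) : Prop :=
         if k is k'.+1
         then exists2 r, iter k' r & eval A d (pairn a (pairn k' r)) m
         else eval A c a m) (Cantor.of_nat n).2 m
  | Mu c => fun n m =>
      eval A c (pairn n m) 0%N /\
      forall i, (i < m)%N -> exists k, eval A c (pairn n i) k.+1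
  end.

(* Goedel numbering: numbers outside the range of [encode] index nothing. *)
Fixpoint encode (c : code) : nat :=
  match c with
  | Zero => pairn 0 0
  | Succ => pairn 1 0
  | Fst => pairn 2 0
  | Snd => pairn 3 0
  | Query => pairn 4 0
  | Pair c d => pairn 5 (pairn (encode c) (encode d))
  | Comp c d => pairn 6 (pairn (encode c) (encode d))
  | Prec c d => pairn 7 (pairn (encode c) (encode d))
  | Mu c => pairn 8 (encode c)
  end.

Lemma encode_inj : injective encode.
Proof.
have pI a b a' b' : pairn a b = pairn a' b' -> a = a' /\ b = b'.
  by move=> /Cantor.to_nat_inj[].
elim=> [||||| c IHc d IHd | c IHc d IHd | c IHc d IHd | c IHc] [] //=.
all: try by move=> >; move=> /pI[].
all: try by move=> >; move=> /pI[_ /pI[/IHc -> /IHd ->]].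
by move=> >; move=> /pI[_ /IHc ->].
Qed.

(* g <=_T A *)
Definition turing_fun (g : nat -> nat) (A : nat -> bool) : Prop :=
  exists c, forall n, eval A c n (g n).

Definition ce_in (A : nat -> bool) (W : set nat) : Prop :=
  exists c, W = [set n | exists m, eval A c n m].

(* 0' = {e : phi_e(e) halts}; oracle [fun=> false] is the empty set. *)
Definition zero_jump : nat -> bool :=
  fun e => `[< exists c, encode c = e /\ exists m, eval (fun=> false) c e m >].

Definition cylinder (s : seq bool) : set (nat -> bool) :=
  [set X | mkseq X (size s) = s].

(* The bijective base-2 numbering of binary strings. *)
Fixpoint string_code (s : seq bool) : nat :=
  if s is b :: s' then (b + (string_code s').*2).+1 else 0%N.

(* U_n is the open set generated by the n-th section of a single A-c.e. set. *)
Definition uniformly_Sigma01 (A : nat -> bool) (U : nat -> set (nat -> bool)) :=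
  exists2 W, ce_in A W &
    forall n, U n = \bigcup_(s in [set s | W (pairn n (string_code s))])
                      cylinder s.

(* 2^omega with its Borel sigma-algebra (cylinders are a countable base). *)
Definition cantor := g_sigma_algebraType (range cylinder).

Section fair_coin.
Context (R : realType).

Definition binary_digits (x : measurableTypeR R) : cantor :=
  fun n => odd (Num.truncn (x * 2 ^+ n.+1)).

Lemma measurable_binary_digits : measurable_fun [set: _] binary_digits.
Proof.
have mtrunc n k :
    measurable [set x : measurableTypeR R | Num.truncn (x * 2 ^+ n) = k].
  have e j : [set x : measurableTypeR R | (Num.truncn (x * 2 ^+ n) <= j)%N] =
      [set` `]-oo, (j.+1%:R / 2 ^+ n)[].
    apply/seteqP; split=> x /=; rewrite in_itv/= truncn_le_nat.
      by rewrite ltr_pdivlMr ?exprn_gt0.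
    by rewrite ltr_pdivlMr ?exprn_gt0.
  have mle j : measurable
      [set x : measurableTypeR R | (Num.truncn (x * 2 ^+ n) <= j)%N].
    by rewrite e; exact: measurable_itv.
  case: k => [|k].
    rewrite (_ : [set _ | _] =
        [set x : measurableTypeR R | (Num.truncn (x * 2 ^+ n) <= 0)%N]).
      exact: mle.
    by apply/seteqP; split=> x /=; rewrite leqn0 => /eqP.
  rewrite (_ : [set _ | _] =
      [set x : measurableTypeR R | (Num.truncn (x * 2 ^+ n) <= k.+1)%N] `\`
      [set x : measurableTypeR R | (Num.truncn (x * 2 ^+ n) <= k)%N]).
    exact: measurableD.
  apply/seteqP; split=> x /=; first by move=> ->; rewrite ltnn leqnn.
  by case=> h1 /negP; rewrite -ltnNge => h2; apply/eqP; rewrite eqn_leq h1.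
have mdigit n b : measurable [set x | binary_digits x n = b].
  rewrite (_ : [set _ | _] = \bigcup_(k in [set k | odd k = b])
      [set x : measurableTypeR R | Num.truncn (x * 2 ^+ n.+1) = k]).
    by apply: bigcup_measurable => k _; exact: mtrunc.
  by apply/seteqP; split=> x /=; [move=> h; exists (Num.truncn (x * 2 ^+ n.+1))
                                 |move=> [k /= <- <-]].
apply: (@measurability _ _ _ _ [set: measurableTypeR R] binary_digits
  (range cylinder)) => //.
move=> _ [_ [s _ <-] <-]; rewrite setTI.
rewrite (_ : _ @^-1` _ = \bigcap_(i in [set i | (i < size s)%N])
    [set x | binary_digits x i = nth false s i]).
  by apply: bigcap_measurableType => i _; exact: mdigit.
apply/seteqP; split=> x /=.
  by rewrite /cylinder/= => <- i /=; rewrite size_mkseq => ilt; rewrite nth_mkseq.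
move=> h; rewrite /cylinder/=; apply: (@eq_from_nth _ false).
  by rewrite size_mkseq.
by move=> i; rewrite size_mkseq => ilt; rewrite nth_mkseq// h.
Qed.

HB.instance Definition _ := isMeasurableFun.Build _ _ _ _
  binary_digits measurable_binary_digits.

(* The law of the binary digits of a uniform point of [0, 1]; characterized by
   [fair_coin_cylinder] below. *)
Definition fair_coin : probability cantor R :=
  distribution (uniform_prob (@ltr01 R)) binary_digits.

Lemma fair_coin_cylinder (s : seq bool) :
  fair_coin (cylinder s) = (2^-1 ^+ size s)%:E.
Proof.
have mcyl : measurable (cylinder s : set cantor).
  by apply: sub_sigma_algebra; exists s.
have mpre : measurable (binary_digits @^-1` cylinder s).
  by rewrite -[X in measurable X]setTI; exact: measurable_binary_digits.
rewrite /fair_coin /distribution /pushforward /= /uniform_prob.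
rewrite integral_uniform_pdf (eq_integral (fun=> 1%:E)); last first.
  move=> x; rewrite inE => -[_ /=]; rewrite in_itv/= /uniform_pdf => ->.
  by rewrite subr0 invr1.
rewrite integral_cst//=; last exact: measurableI.
rewrite mul1e.
pose val := foldl (fun a (b : bool) => (b + a.*2)%N) 0%N.
have valS t b : val (rcons t b) = (b + (val t).*2)%N.
  by rewrite /val foldl_rcons.
have val_lt t : (val t < 2 ^ size t)%N.
  elim/last_ind: t => [//|t b IH]; rewrite valS size_rcons expnS mul2n.
  by move: (val t) (2 ^ _)%N IH => v m IH; rewrite -!muln2; case: b => /=; lia.
have half (x : R) n : 0 <= x ->
    (Num.truncn (x * 2 ^+ n.+1))./2 = Num.truncn (x * 2 ^+ n).
  move=> x0; set k := Num.truncn (x * 2 ^+ n.+1).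
  have /truncn_itv : 0 <= x * 2 ^+ n.+1 by rewrite mulr_ge0// exprn_ge0.
  rewrite -/k -{1 2}(odd_double_half k) exprS mulrCA => /andP[h1 h2].
  apply/esym/truncn_def; move: h1 h2.
  rewrite -!natr1 !natrD -!muln2 !natrM.
  by case: (odd k) => /=; set y := x * _; lra.
have digitsE (x : R) t : 0 <= x < 1 -> mkseq (binary_digits x) (size t) = t <->
    Num.truncn (x * 2 ^+ size t) = val t.
  move=> /andP[x0 x1]; elim/last_ind: t => [|t b IH].
    split=> // _; rewrite /= expr0 mulr1; apply/truncn_def.
    by rewrite x0 x1.
  rewrite size_rcons mkseqS valS; split.
    move/rcons_inj => [/IH h <-].
    by rewrite -h -(half _ (size t))// /binary_digits odd_double_half.
  move=> h; congr rcons.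
    by apply/IH; rewrite -(half _ (size t))// h; case: (b); rewrite /= ?add1n ?add0n ?uphalf_double ?doubleK.
  by rewrite /binary_digits h oddD odd_double addbF; case: (b).
have p0 : (0 : R) < 2 ^+ size s by rewrite exprn_gt0.
have p0' : (2 ^+ size s : R) != 0 by rewrite gt_eqF.
have valR : ((val s).+1%:R : R) <= 2 ^+ size s.
  by rewrite -natrX ler_nat.
have itvE : binary_digits @^-1` cylinder s `&` `[0, 1[ =
    [set` `[(val s)%:R / 2 ^+ size s, (val s).+1%:R / 2 ^+ size s[].
  apply/seteqP; split=> x /=; rewrite !in_itv/= ler_pdivrMr// ltr_pdivlMr//.
    move=> [/= h x01]; have {h} := (digitsE _ _ x01).1 h.
    move=> <-; apply: truncn_itv.
    by case/andP: x01 => x0 _; rewrite mulr_ge0 // ltW.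
  move=> /andP[h1 h2].
  have x01 : 0 <= x < 1.
    apply/andP; split.
      by rewrite -(pmulr_lge0 _ p0); apply: le_trans h1.
    by rewrite -(ltr_pM2r p0) mul1r; apply: lt_le_trans valR.
  split=> //; apply/digitsE => //; apply/truncn_def.
  by rewrite h1 h2.
have -> : binary_digits @^-1` cylinder s `&` `[0, 1] =
    (binary_digits @^-1` cylinder s `&` `[0, 1[) `|`
    (binary_digits @^-1` cylinder s `&` [set 1]).
  by rewrite -setIUr setUitv1 // bnd_simp.
have m1 : measurable (binary_digits @^-1` cylinder s `&` [set (1 : R)]).
  by apply: measurableI => //; exact: measurable_set1.
have n1 : lebesgue_measure (binary_digits @^-1` cylinder s `&` [set 1]) = 0%E.
  by apply: (subset_measure0 m1 (measurable_set1 _)) (lebesgue_measure_set1 1).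
rewrite measureU0//; last by rewrite itvE; exact: measurable_itv.
rewrite itvE; apply: (eq_trans (lebesgue_measure_itv _)); rewrite /= lte_fin ltr_pM2r ?invr_gt0// ltr_nat ltnSn.
by rewrite -EFinB -mulrBl -natr1 addrAC subrr add0r mul1r exprVn.
Qed.

End fair_coin.

Definition martin_lof_test (R : realType) (A : nat -> bool)
    (U : nat -> set (nat -> bool)) : Prop :=
  uniformly_Sigma01 A U /\ forall n, (fair_coin R (U n) <= (2^-1 ^+ n)%:E)%E.

Definition random_in (R : realType) (A X : nat -> bool) : Prop :=
  forall U, martin_lof_test R A U -> ~ (\bigcap_n U n) X.

Definition two_random (R : realType) (X : nat -> bool) : Prop :=
  random_in R zero_jump X.

Definition dominates (f g : nat -> nat) : Prop :=
  exists m, forall n, (m < n)%N -> (g n < f n)%N.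

Definition ae_dominating (R : realType) (A : nat -> bool) : Prop :=
  {ae fair_coin R, forall X : cantor, forall g, turing_fun g X ->
     exists2 f, turing_fun f A & dominates f g}.

(* Main.v *)
(* Almost everywhere domination turns [Pi_2] classes of positive measure into
   subclasses of positive measure that are [Pi_1] in [Z].  Suppose [X] lies in
   every [U n] of a test relative to [0'].  The points some of whose finite
   extensions to the left [s ++ Y] lie in [U (2 * string_code s + 2)] form a
   class [V] of measure at most 1/2, and every tail of [X] is in [V].  By Post's
   theorem [V] is defined by a computable [exists n, forall b] condition, so a
   point [Y] outside [V] computes the function giving the least counterexample
   [b] for each [n].  Bounding this function by some [h] computable from [Z], for
   a non-null set of [Y], replaces [forall b] by [forall b < h n]: this gives a
   superset of [V], open relative to [Z] and of measure below 1.  By Kucera's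
   argument some tail of the 1-[Z]-random point [X] lies outside it. *)

From HB Require Import structures.
Require Import Defs.
From mathcomp Require Import all_boot all_order all_algebra.
From mathcomp Require Import all_classical all_reals all_analysis.
From mathcomp Require Import zify.
From Stdlib Require Cantor.

Set Implicit Arguments.
Unset Strict Implicit.
Unset Printing Implicit Defensive.

Import Order.TTheory GRing.Theory Num.Theory.

(** * Computable functions *)

(** Domination helps only off a null set and up to a choice among countably many functions, so it
    yields an open superset of measure below 1, with no control on how far below. Such a class
    cannot itself serve as a late component of a test. Powers of its measure can, provided that the
    random point enters the class again after every restart; hence the detour through a class that
    holds all tails of [X]. Stripping a prefix of length at most [x] may multiply a measure by
    [2 ^ x]; the component of index [2x + 2] pays for this and leaves [2 ^ -(x + 2)], with sum 1/2.
    Post's theorem rests on certificates: a number lists claims about computations, each justified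
    by later items of the list, so that checking is computable. Only answers of the oracle [0']
    escape an outright check. One and the same [b] is tried against all the negative answers in a
    certificate, which gives the form [exists a, forall b] directly. *)

Definition fstn n := (Cantor.of_nat n).1.
Definition sndn n := (Cantor.of_nat n).2.

Lemma of_nat_fstn n : (Cantor.of_nat n).1 = fstn n. Proof. by []. Qed.

Lemma of_nat_sndn n : (Cantor.of_nat n).2 = sndn n. Proof. by []. Qed.

Lemma fstn_pairn x y : fstn (pairn x y) = x.
Proof. by rewrite /fstn Cantor.cancel_of_to. Qed.

Lemma sndn_pairn x y : sndn (pairn x y) = y.
Proof. by rewrite /sndn Cantor.cancel_of_to. Qed.

Definition pairnE := (fstn_pairn, sndn_pairn).

Lemma pairn_proj n : pairn (fstn n) (sndn n) = n.
Proof. by rewrite /pairn /fstn /sndn -surjective_pairing Cantor.cancel_to_of. Qed.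

Lemma pairn_ge x y : (x + y <= pairn x y)%N.
Proof. by have := Cantor.to_nat_non_decreasing x y; rewrite /pairn; lia. Qed.

Lemma fstn_le n : (fstn n <= n)%N.
Proof. by rewrite -{2}(pairn_proj n); apply: leq_trans (pairn_ge _ _); lia. Qed.

Lemma sndn_le n : (sndn n <= n)%N.
Proof. by rewrite -{2}(pairn_proj n); apply: leq_trans (pairn_ge _ _); lia. Qed.

Lemma pairn_snd_lt x y : (0 < y)%N -> (y < pairn x y)%N.
Proof.
by move=> y0; rewrite /pairn; have := Cantor.to_nat_spec x y; nia.
Qed.

Lemma pairn00 : pairn 0 0 = 0%N. Proof. by []. Qed.

(** Makes [sndn] a well-founded tail operation, so that numbers can be read as finite lists. *)
Lemma sndn_lt n : (0 < n)%N -> (sndn n < n)%N.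
Proof.
move=> n0; rewrite -{2}(pairn_proj n); case: (posnP (sndn n)) => [e|]; last exact: pairn_snd_lt.
have : (0 < pairn (fstn n) (sndn n))%N by rewrite pairn_proj.
by rewrite e.
Qed.

#[local] Opaque pairn fstn sndn.

Section closure.
Variable A : nat -> bool.
Notation T f := (turing_fun f A).

Lemma tf_ext f g : T f -> f =1 g -> T g.
Proof. by move=> [c h] e; exists c => n; rewrite -e. Qed.

Lemma tf_id : T (fun n => n).
Proof.
exists (Pair Fst Snd) => n /=; exists (fstn n), (sndn n); split=> //.
by rewrite pairn_proj.
Qed.

Lemma tf_comp g f : T g -> T f -> T (fun n => g (f n)).
Proof. by move=> [c h] [d k]; exists (Comp c d) => n /=; exists (f n). Qed.

Lemma tf_succ f : T f -> T (fun n => (f n).+1).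
Proof. by apply: (@tf_comp S); exists Succ. Qed.

Lemma tf_fstn f : T f -> T (fun n => fstn (f n)).
Proof. by apply: (@tf_comp fstn); exists Fst. Qed.

Lemma tf_sndn f : T f -> T (fun n => sndn (f n)).
Proof. by apply: (@tf_comp sndn); exists Snd. Qed.

Lemma tf_oracle f : T f -> T (fun n => nat_of_bool (A (f n))).
Proof. by apply: (@tf_comp (fun n => nat_of_bool (A n))); exists Query. Qed.

Lemma tf_pair f g : T f -> T g -> T (fun n => pairn (f n) (g n)).
Proof.
by move=> [c h] [d k]; exists (Pair c d) => n /=; exists (f n), (g n).
Qed.

Lemma tf_const k : T (fun _ => k).
Proof.
elim: k => [|k IH]; last exact: tf_succ.
by exists Zero.
Qed.

(** Primitive recursion with a parameter [n]: the step function receives the packed triple of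
    parameter, index and previous value. Conditionals, arithmetic and bounded quantifiers are all
    obtained from this. *)
Lemma tf_iteri f h k : T f -> T (fun z => h (fstn z) (fstn (sndn z)) (sndn (sndn z))) ->
  T k -> T (fun n => iteri (k n) (h n) (f n)).
Proof.
move=> [c hc] [d hd] hk.
suff hr : T (fun z => iteri (sndn z) (h (fstn z)) (f (fstn z))).
  apply: (@tf_ext (fun n => iteri (sndn (pairn n (k n))) (h (fstn (pairn n (k n))))
    (f (fstn (pairn n (k n)))))); last by move=> n; rewrite !pairnE.
  by apply: (tf_comp hr); apply: tf_pair => //; exact: tf_id.
exists (Prec c d) => n /=; rewrite !of_nat_fstn !of_nat_sndn.
elim: (sndn n) => [|k' IH] /=; first exact: hc.
exists (iteri k' (h (fstn n)) (f (fstn n))) => //.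
by have := hd (pairn (fstn n) (pairn k' (iteri k' (h (fstn n)) (f (fstn n))))); rewrite !pairnE.
Qed.

Lemma tf_comp2 g f h : T (fun z => g (fstn z) (sndn z)) -> T f -> T h ->
  T (fun n => g (f n) (h n)).
Proof.
move=> hg hf hh.
apply: (@tf_ext (fun n => g (fstn (pairn (f n) (h n))) (sndn (pairn (f n) (h n))))).
  by apply: (tf_comp hg); exact: tf_pair.
by move=> n; rewrite !pairnE.
Qed.

Lemma tf_if (P : nat -> bool) f g : T (fun n => nat_of_bool (P n)) -> T f -> T g ->
  T (fun n => if P n then f n else g n).
Proof.
move=> hP hf hg; apply: (@tf_ext (fun n => iteri (P n) (fun _ _ => f n) (g n))).
  apply: (@tf_iteri g (fun n _ _ => f n)) => //.
  by apply: (tf_comp hf); apply: tf_fstn; exact: tf_id.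
by move=> n; case: (P n).
Qed.

Lemma tf_add f g : T f -> T g -> T (fun n => (f n + g n)%N).
Proof.
move=> hf hg; apply: (@tf_ext (fun n => iteri (g n) (fun _ r => r.+1) (f n))).
  apply: (@tf_iteri f (fun _ _ r => r.+1)) => //.
  by apply: tf_succ; do 2 apply: tf_sndn; exact: tf_id.
by move=> n; elim: (g n) => [|m IH] /=; rewrite ?addn0 // IH addnS.
Qed.

Lemma tf_pred f : T f -> T (fun n => (f n).-1).
Proof.
(* Each step discards the previous value and returns its index; the last index is the
   predecessor. *)
move=> hf; apply: (@tf_ext (fun n => iteri (f n) (fun i _ => i) 0%N)).
  apply: (@tf_iteri (fun=> 0%N) (fun _ i _ => i)) => //; first exact: tf_const.
  by apply: tf_fstn; apply: tf_sndn; exact: tf_id.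
by move=> n; case: (f n).
Qed.

Lemma tf_sub f g : T f -> T g -> T (fun n => (f n - g n)%N).
Proof.
move=> hf hg; apply: (@tf_ext (fun n => iteri (g n) (fun _ r => r.-1) (f n))).
  apply: (@tf_iteri f (fun _ _ r => r.-1)) => //.
  by apply: tf_pred; do 2 apply: tf_sndn; exact: tf_id.
by move=> n; elim: (g n) => [|m IH] /=; rewrite ?subn0 // IH subnS.
Qed.

Lemma tf_mul f g : T f -> T g -> T (fun n => (f n * g n)%N).
Proof.
move=> hf hg; apply: (@tf_ext (fun n => iteri (g n) (fun _ r => (r + f n)%N) 0%N)).
  apply: (@tf_iteri (fun=> 0%N) (fun n _ r => (r + f n)%N)) => //; first exact: tf_const.
  apply: tf_add; first by do 2 apply: tf_sndn; exact: tf_id.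
  by apply: (tf_comp hf); apply: tf_fstn; exact: tf_id.
by move=> n; elim: (g n) => [|m IH] /=; rewrite ?muln0 // IH mulnSr.
Qed.

Lemma tf_negb (P : nat -> bool) : T (fun n => nat_of_bool (P n)) ->
  T (fun n => nat_of_bool (~~ P n)).
Proof.
move=> hP; apply: (@tf_ext (fun n => (1 - P n)%N)).
  by apply: tf_sub => //; exact: tf_const.
by move=> n; case: (P n).
Qed.

Lemma tf_andb (P Q : nat -> bool) : T (fun n => nat_of_bool (P n)) ->
  T (fun n => nat_of_bool (Q n)) -> T (fun n => nat_of_bool (P n && Q n)).
Proof.
move=> hP hQ; apply: (@tf_ext (fun n => (P n * Q n)%N)).
  exact: tf_mul.
by move=> n; rewrite mulnb.
Qed.

Lemma tf_orb (P Q : nat -> bool) : T (fun n => nat_of_bool (P n)) ->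
  T (fun n => nat_of_bool (Q n)) -> T (fun n => nat_of_bool (P n || Q n)).
Proof.
move=> hP hQ; apply: (@tf_ext (fun n => nat_of_bool (~~ (~~ P n && ~~ Q n)))).
  by apply: tf_negb; apply: tf_andb; exact: tf_negb.
by move=> n; rewrite negb_and !negbK.
Qed.

Lemma tf_pos f : T f -> T (fun n => nat_of_bool (0 < f n)%N).
Proof.
move=> hf; apply: (@tf_ext (fun n => (1 - (1 - f n))%N)).
  by do 2 (apply: tf_sub; first exact: tf_const).
by move=> n; case: (f n).
Qed.

Lemma tf_leq f g : T f -> T g -> T (fun n => nat_of_bool (f n <= g n)%N).
Proof.
move=> hf hg; apply: (@tf_ext (fun n => nat_of_bool (~~ (0 < f n - g n)%N))).
  by apply: tf_negb; apply: tf_pos; exact: tf_sub.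
by move=> n; rewrite subn_gt0 -leqNgt.
Qed.

Lemma tf_eqn f g : T f -> T g -> T (fun n => nat_of_bool (f n == g n)).
Proof.
move=> hf hg; apply: (@tf_ext (fun n => nat_of_bool ((f n <= g n) && (g n <= f n))%N)).
  by apply: tf_andb; exact: tf_leq.
by move=> n; rewrite -eqn_leq.
Qed.

Lemma tf_has (P : nat -> nat -> bool) k :
  T (fun z => nat_of_bool (P (fstn z) (sndn z))) -> T k ->
  T (fun n => nat_of_bool (has (P n) (iota 0 (k n)))).
Proof.
move=> hP hk.
apply: (@tf_ext (fun n => iteri (k n) (fun i r => nat_of_bool ((0 < r)%N || P n i)) 0%N)).
  apply: (@tf_iteri (fun=> 0%N) (fun n i r => nat_of_bool ((0 < r)%N || P n i))) => //.
    exact: tf_const.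
  apply: tf_orb; first by apply: tf_pos; do 2 apply: tf_sndn; exact: tf_id.
  apply: (@tf_comp2 (fun a b => nat_of_bool (P a b))) => //; first by apply: tf_fstn; exact: tf_id.
  by apply: tf_fstn; apply: tf_sndn; exact: tf_id.
move=> n; elim: (k n) => [//|m IH]; rewrite -[m.+1 in RHS]addn1 iotaD has_cat /= IH.
by rewrite orbF add0n lt0b.
Qed.

Lemma tf_all (P : nat -> nat -> bool) k :
  T (fun z => nat_of_bool (P (fstn z) (sndn z))) -> T k ->
  T (fun n => nat_of_bool (all (P n) (iota 0 (k n)))).
Proof.
move=> hP hk.
apply: (@tf_ext (fun n => nat_of_bool (~~ has (fun i => ~~ P n i) (iota 0 (k n))))).
  apply: tf_negb; apply: (@tf_has (fun n i => ~~ P n i)) => //; exact: tf_negb.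
by move=> n; rewrite -all_predC; congr nat_of_bool; apply: eq_all => i /=; rewrite negbK.
Qed.

Lemma tf_odd f : T f -> T (fun n => nat_of_bool (odd (f n))).
Proof.
move=> hf; apply: (@tf_ext (fun n => iteri (f n) (fun _ r => (1 - r)%N) 0%N)).
  apply: (@tf_iteri (fun=> 0%N) (fun _ _ r => (1 - r)%N)) => //; first exact: tf_const.
  by apply: tf_sub; [exact: tf_const|do 2 apply: tf_sndn; exact: tf_id].
by move=> n; elim: (f n) => [//|m IH] /=; rewrite IH; case: odd.
Qed.

Lemma tf_half f : T f -> T (fun n => (f n)./2).
Proof.
(* The half of a number counts the odd numbers below it. *)
move=> hf; apply: (@tf_ext (fun n => iteri (f n) (fun i r => (odd i + r)%N) 0%N)).
  apply: (@tf_iteri (fun=> 0%N) (fun _ i r => (odd i + r)%N)) => //; first exact: tf_const.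
  apply: tf_add; last by do 2 apply: tf_sndn; exact: tf_id.
  by apply: tf_odd; apply: tf_fstn; apply: tf_sndn; exact: tf_id.
by move=> n; elim: (f n) => [//|m IH] /=; rewrite IH uphalf_half.
Qed.

Lemma tf_double f : T f -> T (fun n => (f n).*2).
Proof.
move=> hf; apply: (@tf_ext (fun n => (f n + f n)%N)); first exact: tf_add.
by move=> n; rewrite addnn.
Qed.

Lemma tf_iter g f k : T g -> T f -> T k -> T (fun n => iter (k n) g (f n)).
Proof.
move=> hg hf hk; apply: (@tf_ext (fun n => iteri (k n) (fun _ r => g r) (f n))).
  by apply: (@tf_iteri f (fun _ _ => g)) => //; apply: (tf_comp hg);
    do 2 apply: tf_sndn; exact: tf_id.
by move=> n; elim: (k n) => [//|m IH] /=; rewrite IH.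
Qed.

End closure.

Ltac tf := repeat first
  [ assumption | simple apply tf_const | simple apply tf_id
  | simple apply tf_fstn | simple apply tf_sndn | simple apply tf_pair
  | simple apply tf_andb | simple apply tf_orb | simple apply tf_negb
  | simple apply tf_eqn | simple apply tf_pos | simple apply tf_leq | simple apply tf_odd
  | simple apply tf_if | simple apply tf_has | simple apply tf_all
  | simple apply tf_succ | simple apply tf_pred | simple apply tf_add
  | simple apply tf_sub | simple apply tf_mul | simple apply tf_half | simple apply tf_double
  | simple apply tf_iteri | simple apply tf_iter ].

(** * Derivation certificates *)

Lemma tf_comp3 A g f h k : turing_fun (fun z => g (fstn z) (fstn (sndn z)) (sndn (sndn z))) A ->
  turing_fun f A -> turing_fun h A -> turing_fun k A ->
  turing_fun (fun n => g (f n) (h n) (k n)) A.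
Proof.
move=> hg hf hh hk; apply: (@tf_ext A (fun n => g (fstn (pairn (f n) (pairn (h n) (k n))))
  (fstn (sndn (pairn (f n) (pairn (h n) (k n)))))
  (sndn (sndn (pairn (f n) (pairn (h n) (k n))))))); last by move=> n; rewrite !pairnE.
by apply: (tf_comp hg); tf.
Qed.

Lemma tf_comp4 A g f h k l :
  turing_fun (fun z => g (fstn z) (fstn (sndn z)) (fstn (sndn (sndn z)))
    (sndn (sndn (sndn z)))) A ->
  turing_fun f A -> turing_fun h A -> turing_fun k A -> turing_fun l A ->
  turing_fun (fun n => g (f n) (h n) (k n) (l n)) A.
Proof.
move=> hg hf hh hk hl.
pose g' a b c := g a b (fstn c) (sndn c).
apply: (@tf_ext A (fun n => g' (f n) (h n) (pairn (k n) (l n)))).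
  by apply: tf_comp3 => //; tf.
by move=> n; rewrite /g' !pairnE.
Qed.

Lemma eval_Prec0 A c d a m : Defs.eval A (Prec c d) (pairn a 0) m <-> Defs.eval A c a m.
Proof. by rewrite /= !of_nat_fstn !of_nat_sndn !pairnE. Qed.

Lemma eval_PrecS A c d a k m : Defs.eval A (Prec c d) (pairn a k.+1) m <->
  exists2 r, Defs.eval A (Prec c d) (pairn a k) r & Defs.eval A d (pairn a (pairn k r)) m.
Proof. by rewrite /= !of_nat_fstn !of_nat_sndn !pairnE. Qed.

Lemma eval_fun A c n m m' : Defs.eval A c n m -> Defs.eval A c n m' -> m = m'.
Proof.
elim: c n m m' => [||||| c IHc d IHd | c IHc d IHd | c IHc d IHd | c IHc] n m m';
  try by move=> /= -> ->.
- move=> /= [x [y [h1 h2 ->]]] [x' [y' [h1' h2' ->]]].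
  by rewrite (IHc _ _ _ h1 h1') (IHd _ _ _ h2 h2').
- move=> /= [x h1 h2] [x' h1' h2'].
  by move: h2; rewrite (IHd _ _ _ h1 h1') => /IHc; exact.
- rewrite -(pairn_proj n); elim: (sndn n) m m' => [|k IH] m m'.
    by move=> /eval_Prec0 h /eval_Prec0 h'; exact: IHc h h'.
  move=> /eval_PrecS[r h1 h2] /eval_PrecS[r' h1' h2'].
  by move: h2; rewrite (IH _ _ h1 h1') => /IHd; exact.
- move=> /= [h1 h2] [h1' h2'].
  case: (ltngtP m m') => // lt.
    by have [k /(IHc _ _ _ h1)] := h2' _ lt.
  by have [k /(IHc _ _ _ h1')] := h2 _ lt.
Qed.

(* A number is read as the list of the [entry l i], which are eventually [0].
   The entry <e, <n, <v, w>>> claims that [e] is the index of some code and, when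
   [v = m.+1], that this code maps [n] to [m]; [w] is a witness for oracle queries.
   The default entry [0] is the true claim that [0 = encode Zero] is an index. *)
Definition entry l i := fstn (iter i sndn l).
Definition e_code y := fstn y.
Definition e_in y := fstn (sndn y).
Definition e_out y := fstn (sndn (sndn y)).
Definition e_wit y := sndn (sndn (sndn y)).

(** Entries from index [l] on are all the default 0. The bound [l.+1] includes one of them, so the
    search is equivalent to one over all indices. *)
Definition ex_entry l (P : nat -> bool) := has (fun i => P (entry l i)) (iota 0 l.+1).

Definition matches e n v y := [&& e_code y == e, e_in y == n & e_out y == v].

Definition listed l e n v := ex_entry l (fun y => matches e n v y).

(* [listed l e 0 0] claims that [e] is an index. *)
Definition formed e l :=
  [|| (fstn e <= 4) && (sndn e == 0),
      [&& 5 <= fstn e, fstn e <= 7, listed l (fstn (sndn e)) 0 0 & listed l (sndn (sndn e)) 0 0]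
    | (fstn e == 8) && listed l (sndn e) 0 0]%N.

(** One rule per constructor other than [Query], with two for [Prec]; [v] is the output plus one. A
    recursion stopped at 0 never runs its step code, so that rule asks separately for the claim that
    the step code is an index. In the [Mu] rule, [1 < e_out y] says that the value is positive. *)
Definition derived e n v l :=
  [|| [&& fstn e == 0, sndn e == 0 & v == 1],
      [&& fstn e == 1, sndn e == 0 & v == n.+2],
      [&& fstn e == 2, sndn e == 0 & v == (fstn n).+1],
      [&& fstn e == 3, sndn e == 0 & v == (sndn n).+1],
      [&& fstn e == 5, 0 < v, listed l (fstn (sndn e)) n (fstn v.-1).+1
        & listed l (sndn (sndn e)) n (sndn v.-1).+1],
      (fstn e == 6) && ex_entry l (fun y =>
        [&& e_code y == sndn (sndn e), e_in y == n, 0 < e_out y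
          & listed l (fstn (sndn e)) (e_out y).-1 v]),
      [&& fstn e == 7, sndn n == 0, listed l (fstn (sndn e)) (fstn n) v
        & listed l (sndn (sndn e)) 0 0],
      [&& fstn e == 7, 0 < sndn n & ex_entry l (fun y =>
        [&& e_code y == e, e_in y == pairn (fstn n) (sndn n).-1, 0 < e_out y
          & listed l (sndn (sndn e))
              (pairn (fstn n) (pairn (sndn n).-1 (e_out y).-1)) v])]
    | [&& fstn e == 8, listed l (sndn e) (pairn n v.-1) 1
        & all (fun i => ex_entry l (fun y =>
            [&& e_code y == sndn e, e_in y == pairn n i & 1 < e_out y]))
          (iota 0 v.-1)]]%N.

(** The treatment of oracle answers is left to [q], so one checker serves both the empty oracle and
    [0']; [pairn 4 0] is the index of [Query]. *)
Definition justified (q : nat -> nat -> nat -> bool) y l :=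
  if e_out y == 0%N then formed (e_code y) l else
  derived (e_code y) (e_in y) (e_out y) l
  || (e_code y == pairn 4 0) && q (e_in y) (e_out y).-1 (e_wit y).

(** Positions from [d] on hold the default claim, which is always justified, so the bound [d] loses
    nothing. *)
Definition valid q d :=
  all (fun i => justified q (fstn (iter i sndn d)) (sndn (iter i sndn d))) (iota 0 d).

Lemma tf_ex_entry A (P : nat -> nat -> bool) l :
  turing_fun (fun z => nat_of_bool (P (fstn z) (sndn z))) A -> turing_fun l A ->
  turing_fun (fun n => nat_of_bool (ex_entry (l n) (P n))) A.
Proof.
move=> hP hl; apply: (@tf_has A (fun n i => P n (entry (l n) i))); last by tf.
apply: (@tf_comp2 A (fun a b => nat_of_bool (P a b))) => //;
  rewrite /entry; tf; apply: (tf_comp hl); tf.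
Qed.

Lemma tf_listed A l e n v :
  turing_fun l A -> turing_fun e A -> turing_fun n A -> turing_fun v A ->
  turing_fun (fun x => nat_of_bool (listed (l x) (e x) (n x) (v x))) A.
Proof.
move=> hl he hn hv; apply: (@tf_ex_entry A (fun x y => matches (e x) (n x) (v x) y)) => //.
rewrite /matches /e_code /e_in /e_out; tf;
  first [apply: (tf_comp he)|apply: (tf_comp hn)|apply: (tf_comp hv)]; tf.
Qed.

Ltac tf2 := repeat first [progress tf | simple apply tf_ex_entry | simple apply tf_listed].

Lemma tf_formed A : turing_fun (fun z => nat_of_bool (formed (fstn z) (sndn z))) A.
Proof. by rewrite /formed; tf2. Qed.

Lemma tf_derived A : turing_fun (fun z => nat_of_bool
  (derived (fstn z) (fstn (sndn z)) (fstn (sndn (sndn z))) (sndn (sndn (sndn z))))) A.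
Proof. by rewrite /derived /e_code /e_in /e_out; tf2. Qed.

Lemma tf_justified A (q : nat -> nat -> nat -> nat -> bool) b y l :
  turing_fun (fun z => nat_of_bool
    (q (fstn z) (fstn (sndn z)) (fstn (sndn (sndn z))) (sndn (sndn (sndn z))))) A ->
  turing_fun b A -> turing_fun y A -> turing_fun l A ->
  turing_fun (fun n => nat_of_bool (justified (q (b n)) (y n) (l n))) A.
Proof.
move=> hq hb hy hl.
apply: (@tf_comp3 A (fun b y l => nat_of_bool (justified (q b) y l))) => //.
rewrite /justified.
pose y' z := fstn (sndn z); pose l' z := sndn (sndn z).
apply: (@tf_ext A (fun z => if e_out (y' z) == 0%N
   then nat_of_bool (formed (e_code (y' z)) (l' z))
   else nat_of_bool (derived (e_code (y' z)) (e_in (y' z)) (e_out (y' z)) (l' z)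
     || (e_code (y' z) == pairn 4 0) &&
        q (fstn z) (e_in (y' z)) (e_out (y' z)).-1 (e_wit (y' z))))); last first.
  by move=> z; case: ifP.
rewrite /y' /l' /e_code /e_in /e_out /e_wit; tf.
- by apply: (@tf_comp2 A (fun a b => nat_of_bool (formed a b))); [exact: tf_formed|tf|tf].
- apply: (@tf_comp4 A (fun e n v l => nat_of_bool (derived e n v l))); last by tf.
  + exact: tf_derived.
  + by tf.
  + by tf.
  + by tf.
- apply: (@tf_comp4 A (fun b n m w => nat_of_bool (q b n m w))) => //; tf.
Qed.

Lemma tf_valid A (q : nat -> nat -> nat -> nat -> bool) b d :
  turing_fun (fun z => nat_of_bool
    (q (fstn z) (fstn (sndn z)) (fstn (sndn (sndn z))) (sndn (sndn (sndn z))))) A ->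
  turing_fun b A -> turing_fun d A ->
  turing_fun (fun n => nat_of_bool (valid (q (b n)) (d n))) A.
Proof.
move=> hq hb hd; apply: (@tf_all A (fun n i =>
  justified (q (b n)) (fstn (iter i sndn (d n))) (sndn (iter i sndn (d n))))) => //.
by apply: tf_justified => //; tf; (apply: (tf_comp hb) + apply: (tf_comp hd)); tf.
Qed.

Lemma iter_sndn_0 i : iter i sndn 0 = 0%N.
Proof. by elim: i => // i /= ->. Qed.

Lemma projn0 : fstn 0 = 0%N /\ sndn 0 = 0%N.
Proof. by rewrite -pairn00 !pairnE. Qed.

Lemma iter_sndn_le i l : (iter i sndn l <= l - i)%N.
Proof.
elim: i => [|i IH] /=; first by rewrite subn0.
case: (posnP (iter i sndn l)) => [->|h]; first by rewrite projn0.2.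
by have := sndn_lt h; lia.
Qed.

Lemma entry0 i : entry 0 i = 0%N.
Proof. by rewrite /entry iter_sndn_0 projn0.1. Qed.

Lemma ex_entryP l (P : nat -> bool) : reflect (exists i, P (entry l i)) (ex_entry l P).
Proof.
apply: (iffP hasP) => [[i _ h]|[i h]]; first by exists i.
case: (leqP i l) => il; first by exists i => //; rewrite mem_iota /= add0n ltnS.
exists l; first by rewrite mem_iota /= add0n ltnSn.
move: h; rewrite /entry.
have := iter_sndn_le i l; have := iter_sndn_le l l.
by rewrite subnn (eqP (ltnW il)) !leqn0 => /eqP -> /eqP ->.
Qed.

(** * Soundness of certificates *)

Definition sound A y := exists2 c, e_code y = encode c &
  (0 < e_out y)%N -> Defs.eval A c (e_in y) (e_out y).-1.

Lemma sound0 A : sound A 0.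
Proof. by exists Zero; rewrite /e_code /e_out ?projn0.1 ?projn0.2 ?projn0.1. Qed.

Lemma listed_sound A l e n v : (forall i, sound A (entry l i)) -> listed l e n v ->
  exists2 c, e = encode c & (0 < v)%N -> Defs.eval A c n v.-1.
Proof.
move=> h /ex_entryP[i /and3P[/eqP <- /eqP <- /eqP <-]]; exact: h.
Qed.

Lemma formed_sound A e l : (forall i, sound A (entry l i)) -> formed e l ->
  exists c, e = encode c.
Proof.
move=> sl; rewrite -(pairn_proj e) /formed !pairnE => /or3P[|
  /and4P[t5 t7 /(listed_sound sl)[c e1 _] /(listed_sound sl)[d e2 _]]|].
- move=> /andP[t4 /eqP ->].
  move: (fstn e) t4 => [|[|[|[|[|//]]]]] _;
    [exists Zero|exists Succ|exists Fst|exists Snd|exists Query] => //.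
- rewrite -(pairn_proj (sndn e)) e1 e2.
  have : fstn e \in [:: 5; 6; 7] by rewrite !inE; lia.
  rewrite !inE => /or3P[]/eqP ->; [exists (Pair c d)|exists (Comp c d)|exists (Prec c d)] => //.
- by move=> /andP[/eqP -> /(listed_sound sl)[c -> _]]; exists (Mu c).
Qed.

Lemma fstn_encode_Prec c : fstn (encode c) = 7 -> exists c1 c2, c = Prec c1 c2.
Proof. by case: c => [|||||c d|c d|c d|c] /=; rewrite !pairnE // => _; exists c, d. Qed.

Lemma derived_sound A e n v l : (forall i, sound A (entry l i)) -> (0 < v)%N ->
  derived e n v l -> exists2 c, e = encode c & Defs.eval A c n v.-1.
Proof.
move=> sl v0; case/or4P; last case/or4P; last case/or3P.
- by move=> /and3P[/eqP t /eqP u /eqP ->]; exists Zero => //; rewrite -(pairn_proj e) t u.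
- by move=> /and3P[/eqP t /eqP u /eqP ->]; exists Succ => //; rewrite -(pairn_proj e) t u.
- by move=> /and3P[/eqP t /eqP u /eqP ->]; exists Fst => //; rewrite -(pairn_proj e) t u.
- by move=> /and3P[/eqP t /eqP u /eqP ->]; exists Snd => //; rewrite -(pairn_proj e) t u.
- move=> /and4P[/eqP t _ /(listed_sound sl)[c h1 h2] /(listed_sound sl)[d k1 k2]].
    exists (Pair c d); first by rewrite -(pairn_proj e) t -(pairn_proj (sndn e)) h1 k1.
    by exists (fstn v.-1), (sndn v.-1); rewrite pairn_proj; split=> //; [exact: h2|exact: k2].
- move=> /andP[/eqP t /ex_entryP[i /and4P[/eqP h1 /eqP h2 h3 /(listed_sound sl)[c k1 k2]]]].
    have [d d1 d2] := sl i.
    exists (Comp c d); first by rewrite -(pairn_proj e) t -(pairn_proj (sndn e)) -h1 d1 k1.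
    by exists (e_out (entry l i)).-1; [rewrite -h2; exact: d2|exact: k2].
- move=> /and4P[/eqP t /eqP n0 /(listed_sound sl)[c h1 h2] /(listed_sound sl)[d k1 _]].
    exists (Prec c d); first by rewrite -(pairn_proj e) t -(pairn_proj (sndn e)) h1 k1.
    by rewrite -(pairn_proj n) n0; apply/eval_Prec0; exact: h2.
- move=> /and3P[/eqP t n0 /ex_entryP[i /and4P[/eqP h1 /eqP h2 h3]]].
  move=> /(listed_sound sl)[d k1 k2].
    have [c' c1 c2] := sl i.
    (* The recursive premise names only the index [e] of the whole recursion. Its tag 7 forces a
       [Prec], and injectivity of [encode] identifies its step code with the one that is listed. *)
    have [c [d' ec]] : exists c d', c' = Prec c d' by apply: fstn_encode_Prec; rewrite -c1 h1.
    move: c1; rewrite ec h1 => c1; have : sndn (sndn e) = encode d' by rewrite c1 /= !pairnE.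
    rewrite k1 => /encode_inj ed; subst d'.
    exists c'; first by rewrite ec c1.
    rewrite ec -(pairn_proj n) -(prednK n0); apply/eval_PrecS.
    exists (e_out (entry l i)).-1; last exact: k2.
    by rewrite -h2 -ec; exact: c2.
- move=> /and3P[/eqP t /(listed_sound sl)[c h1 h2] /allP h].
exists (Mu c); first by rewrite -(pairn_proj e) t h1.
split; first exact: h2.
move=> i iv; have /h/ex_entryP[j /and3P[/eqP g1 /eqP g2 g3]] : i \in iota 0 v.-1.
    by rewrite mem_iota.
have [d d1 d2] := sl j.
(* One unit comes off for the shift of outputs, and one because [eval] wants the positive value in
   the form [k.+1]. *)
exists (e_out (entry l j)).-2; move: d1; rewrite g1 h1 => /encode_inj ->.
by rewrite -g2 prednK; [apply: d2; lia|lia].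
Qed.

Lemma valid_sound (A : nat -> bool) (q : nat -> nat -> nat -> nat -> bool) d :
  (forall n m w, (forall b, q b n m w) -> m = A n) ->
  (forall b, valid (q b) d) -> forall i, sound A (entry d i).
Proof.
move=> qA; elim/ltn_ind: d => d IH vd i.
case: (posnP d) => [->|d0]; first by rewrite entry0; exact: sound0.
have sl : forall i, sound A (entry (sndn d) i).
  move=> j; apply: IH; first exact: sndn_lt.
  move=> b; apply/allP => k; rewrite mem_iota /= add0n => kd; rewrite -iterSr.
  by apply: (allP (vd b)); rewrite mem_iota /= add0n; apply: leq_trans (sndn_lt d0).
case: i => [|i]; last by rewrite /entry iterSr; exact: sl.
have jd b : justified (q b) (fstn d) (sndn d).
  by have /allP/(_ 0%N) := vd b; rewrite mem_iota /= add0n; exact.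
rewrite /entry /=; move: jd; rewrite /justified.
case: posnP => [e0 /(_ 0%N)/(formed_sound sl)[c h]|e0 jd].
  by exists c => //; rewrite e0.
(* Derivability does not mention [b]. When it fails, the oracle alternative therefore holds for
   every [b] at once, as [qA] requires. *)
case: (boolP (derived (e_code (fstn d)) (e_in (fstn d)) (e_out (fstn d)) (sndn d))).
  by move=> /(derived_sound sl e0)[c h1 h2]; exists c.
move=> /negbTE nd; exists Query.
  by have := jd 0%N; rewrite nd /= => /andP[/eqP ->].
move=> _ /=; apply: qA => b.
by have := jd b; rewrite nd /= => /andP[_]; exact.
Qed.

Lemma entry_pairn y l i : entry (pairn y l) i = if i is i'.+1 then entry l i' else y.
Proof. by rewrite /entry; case: i => [|i] /=; rewrite -?iterS ?iterSr pairnE. Qed.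

(** * Completeness of certificates *)

Section completeness.
Variables (A : nat -> bool) (q : nat -> nat -> nat -> nat -> bool).
Hypothesis qA : forall n, exists w, forall b, q b n (A n) w.

Definition cert (s : seq nat) := foldr pairn 0%N s.

(** Rules look up their premises by existence only, so order and repetition are irrelevant and
    derivations are monotone for this preorder. *)
Definition sublist l l' := forall i, exists j, entry l i = entry l' j.

Lemma ex_entry_mono (P Q : nat -> bool) l l' : sublist l l' -> (forall y, P y -> Q y) ->
  ex_entry l P -> ex_entry l' Q.
Proof.
move=> s PQ /ex_entryP[i h]; have [j e] := s i.
by apply/ex_entryP; exists j; rewrite -e; exact: PQ.
Qed.

Lemma listed_mono l l' e n v : sublist l l' -> listed l e n v -> listed l' e n v.
Proof. by move=> s; exact: ex_entry_mono. Qed.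

Lemma formed_mono l l' e : sublist l l' -> formed e l -> formed e l'.
Proof.
move=> /listed_mono s; rewrite /formed.
move=> /or3P[->//|/and4P[-> -> /s-> /s->]|/andP[-> /s->]]; by rewrite ?orbT.
Qed.

Lemma derived_mono l l' e n v : sublist l l' -> derived e n v l -> derived e n v l'.
Proof.
move=> s; have sl := listed_mono s; rewrite /derived.
case/or4P; last case/or4P; last case/or3P.
- by move=> ->.
- by move=> ->; rewrite orbT.
- by move=> ->; rewrite !orbT.
- by move=> ->; rewrite !orbT.
- by move=> /and4P[-> -> /sl-> /sl->]; rewrite !orbT.
- move=> /andP[-> h]; rewrite (ex_entry_mono s _ h) ?orbT //.
  by move=> y /and4P[-> -> -> /sl].
- by move=> /and4P[-> -> /sl-> /sl->]; rewrite !orbT.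
- move=> /and3P[-> -> h]; do 7 (apply/orP; right); apply/orP; left.
  apply: ex_entry_mono h => //.
  by move=> y /and4P[-> -> -> /sl].
- move=> /and3P[-> /sl-> /allP h]; rewrite (_ : all _ _) ?orbT //.
  by apply/allP => i /h; exact: ex_entry_mono.
Qed.

Lemma justified_mono b y l l' : sublist l l' -> justified (q b) y l -> justified (q b) y l'.
Proof.
move=> s; rewrite /justified; case: ifP => _; first exact: formed_mono.
by case/orP => [/(derived_mono s)->//|->]; rewrite orbT.
Qed.

Definition good s := forall b, valid (q b) (cert s).

Lemma justified0 b l : justified (q b) 0 l.
Proof. by rewrite /justified /e_out /e_code !projn0.2 !projn0.1 /= /formed projn0.1 projn0.2. Qed.

Lemma validP b d : valid (q b) d <->
  forall i, justified (q b) (fstn (iter i sndn d)) (sndn (iter i sndn d)).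
Proof.
split=> [/allP h i|h]; last by apply/allP => i _; exact: h.
case: (ltnP i d) => [lt|le]; first by apply: h; rewrite mem_iota.
by have := iter_sndn_le i d; rewrite (eqP le) leqn0 => /eqP ->; rewrite projn0.1 justified0.
Qed.

Lemma good_cons y s : (forall b, justified (q b) y (cert s)) -> good s -> good (y :: s).
Proof.
move=> h gs b; apply/validP => -[|i] /=; first by rewrite !pairnE.
by rewrite -iterS iterSr pairnE; exact: (proj1 (validP b _) (gs b) i).
Qed.

Lemma sublist_catr s1 s2 : sublist (cert s2) (cert (s1 ++ s2)).
Proof.
move=> i; elim: s1 => [|y s1 [j IH]]; first by exists i.
by exists j.+1; rewrite /= entry_pairn.
Qed.

Lemma sublist_catl s1 s2 : sublist (cert s1) (cert (s1 ++ s2)).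
Proof.
elim: s1 => [|y s1 IH] i.
  (* The default entry must be matched too: it is found beyond the end of [s2], for which the number
     [cert s2] itself is a large enough index. *)
  exists (cert s2).
  rewrite entry0 /entry; have := iter_sndn_le (cert s2) (cert s2).
  by rewrite subnn leqn0 => /eqP ->; rewrite projn0.1.
by case: i => [|i]; [exists 0%N|have [j e] := IH i; exists j.+1]; rewrite /= !entry_pairn.
Qed.

Lemma good_cat s1 s2 : good s1 -> good s2 -> good (s1 ++ s2).
Proof.
move=> g1 g2; elim: s1 g1 => [//|y s1 IH] g1; apply: good_cons => /=.
  move=> b; apply: justified_mono (sublist_catl s1 s2) _.
  by have /validP/(_ 0%N) := g1 b; rewrite /= !pairnE.
apply: IH => b; apply/validP => i.
by have /validP/(_ i.+1) := g1 b; rewrite iterSr pairnE.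
Qed.

Definition certified (P : nat -> bool) := exists2 s, good s & ex_entry (cert s) P.

(** Serves the [Mu] rule, which has one premise for each argument below the value found. *)
Lemma gather k (P : nat -> nat -> bool) : (forall i, (i < k)%N -> certified (P i)) ->
  exists2 s, good s & forall i, (i < k)%N -> ex_entry (cert s) (P i).
Proof.
elim: k => [|k IH] h.
  by exists [::] => // b.
have [s1 g1 h1] := IH (fun i ik => h i (ltnW ik)).
have [s2 g2 h2] := h k (ltnSn k).
exists (s1 ++ s2); first exact: good_cat.
move=> i; rewrite ltnS leq_eqVlt => /orP[/eqP ->|/h1].
  by apply: ex_entry_mono h2 => //; exact: sublist_catr.
by apply: ex_entry_mono => //; exact: sublist_catl.
Qed.

Lemma gather2 P Q : certified P -> certified Q ->
  exists s, [/\ good s, ex_entry (cert s) P & ex_entry (cert s) Q].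
Proof.
move=> [s1 g1 h1] [s2 g2 h2]; exists (s1 ++ s2); split; first exact: good_cat.
  by apply: ex_entry_mono h1 => //; exact: sublist_catl.
by apply: ex_entry_mono h2 => //; exact: sublist_catr.
Qed.

Lemma certified_rule s e n v w :
  (forall b, justified (q b) (pairn e (pairn n (pairn v w))) (cert s)) -> good s ->
  certified (matches e n v).
Proof.
move=> h g; exists (pairn e (pairn n (pairn v w)) :: s); first exact: good_cons.
apply/ex_entryP; exists 0%N.
by rewrite /= entry_pairn /matches /e_code /e_in /e_out !pairnE !eqxx.
Qed.

Lemma good_nil : good [::]. Proof. by []. Qed.

Lemma certified_formed s e : formed e (cert s) -> good s -> certified (matches e 0 0).
Proof.
move=> h; apply: (@certified_rule _ _ _ _ 0) => b.
by rewrite /justified /e_code /e_out !pairnE eqxx.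
Qed.

Lemma certified_derived s e n v : (0 < v)%N -> derived e n v (cert s) -> good s ->
  certified (matches e n v).
Proof.
move=> v0 h; apply: (@certified_rule _ _ _ _ 0) => b.
by rewrite /justified /e_code /e_out /e_in !pairnE; case: posnP v0 => // _ _; rewrite h.
Qed.

(** Supplies the index claim for the step code of a recursion stopped at 0. *)
Lemma certified_encode c : certified (matches (encode c) 0 0).
Proof.
elim: c => [|||||c IHc d IHd|c IHc d IHd|c IHc d IHd|c [s g h]];
  try by apply: certified_formed good_nil; rewrite /formed /= !pairnE.
1-3: have [s [g h1 h2]] := gather2 IHc IHd; apply: certified_formed g.
1-3: by rewrite /formed /= !pairnE /= [listed _ _ _ _]h1 [listed _ _ _ _]h2.
by apply: certified_formed g; rewrite /formed /= !pairnE /= [listed _ _ _ _]h.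
Qed.

(** Induction on the code, concatenating the certificates of the premises. By [qA] the witness of
    each query is chosen before [b], so one certificate is valid for all [b]. *)
Lemma certified_eval c n m : Defs.eval A c n m -> certified (matches (encode c) n m.+1).
Proof.
elim: c n m => [|||||c IHc d IHd|c IHc d IHd|c IHc d IHd|c IHc] n m.
- by move=> /= ->; apply: certified_derived good_nil => //; rewrite /derived !pairnE.
- by move=> /= ->; apply: certified_derived good_nil => //; rewrite /derived !pairnE !eqxx.
- by move=> /= ->; apply: certified_derived good_nil => //; rewrite /derived !pairnE !eqxx.
- by move=> /= ->; apply: certified_derived good_nil => //; rewrite /derived !pairnE !eqxx.
- move=> /= ->; have [w h] := qA n.
  apply: (@certified_rule [::] _ _ _ w) good_nil => b.
  by rewrite /justified /e_code /e_in /e_out /e_wit !pairnE /= eqxx h orbT.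
- move=> [x [y [/IHc hx /IHd hy ->]]].
  have [s [g h1 h2]] := gather2 hx hy; apply: certified_derived g => //.
  by rewrite /derived /= !pairnE /= [listed _ _ _ _]h1 [listed _ _ _ _]h2 ?orbT.
- move=> [x /IHd hx /IHc hy].
  have [s [g /ex_entryP[i /and3P[/eqP i1 /eqP i2 /eqP i3]] h2]] := gather2 hx hy.
  apply: certified_derived g => //.
  rewrite /derived /= !pairnE /= (_ : ex_entry _ _) ?orbT //.
  by apply/ex_entryP; exists i; rewrite i1 i2 i3 !eqxx /=.
- rewrite -(pairn_proj n); elim: (sndn n) m => [|k IH] m.
    move=> /eval_Prec0/IHc hx.
    have [s [g h1 h2]] := gather2 hx (certified_encode d); apply: certified_derived g => //.
    by rewrite /derived /= !pairnE /= [listed _ _ _ _]h1 [listed _ _ _ _]h2 ?orbT.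
  move=> /eval_PrecS[r /IH hx /IHd hy].
  have [s [g /ex_entryP[i /and3P[/eqP i1 /eqP i2 /eqP i3]] h2]] := gather2 hx hy.
  apply: certified_derived g => //.
  rewrite /derived /= !pairnE /= (_ : ex_entry _ _) ?orbT //.
  by apply/ex_entryP; exists i; rewrite i1 i2 i3 !eqxx /=.
- move=> [/IHc h0 h].
  have [i im|s1 g1 h1] := @gather m (fun i y =>
      [&& e_code y == encode c, e_in y == pairn n i & 1 < e_out y]%N).
    have [k /IHc[s g hs]] := h i im; exists s => //.
    by apply: (ex_entry_mono (fun j => ex_intro _ j erefl) _ hs) => y /and3P[-> -> /eqP ->].
  have [s0 g0 h0'] := h0.
  apply: (@certified_derived (s0 ++ s1)) (good_cat g0 g1) => //.
  rewrite /derived /= !pairnE /= (listed_mono (sublist_catl _ _) h0') /=.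
  rewrite (_ : all _ _) ?orbT //; apply/allP => i; rewrite mem_iota /= add0n => /h1.
  by apply: ex_entry_mono => //; exact: sublist_catr.
Qed.

End completeness.

(** * Post's theorem *)

Definition halts_by w e := valid (fun _ m _ => m == 0%N) w &&
  ex_entry w (fun y => [&& e_code y == e, e_in y == e & 0 < e_out y]%N).

Lemma zero_jumpP e : zero_jump e <-> exists w, halts_by w e.
Proof.
split=> [/asboolP[c [<- [m h]]]|[w /andP[v /ex_entryP[i /and3P[/eqP h1 /eqP h2 h3]]]]].
  have [|s g hs] := certified_eval (q := fun _ _ m _ => m == 0%N) _ h.
    by move=> n; exists 0%N.
  exists (cert s); rewrite /halts_by (g 0%N) /=.
  by apply: (ex_entry_mono (fun j => ex_intro _ j erefl) _ hs) => y /and3P[-> -> /eqP ->].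
have [c c1 c2] := @valid_sound (fun=> false) (fun _ _ m _ => m == 0%N) w
  (fun n m w h => eqP (h 0%N)) (fun _ => v) i.
apply/asboolP; exists c; split; first by rewrite -c1.
by exists (e_out (entry w i)).-1; rewrite -h2; exact: c2.
Qed.

(* The answer 1 is certified by the halting computation [w]; the answer 0 is
   refuted by some [b], and correct when no [b] refutes it. *)
Definition jump_query b n m w :=
  (m == 1%N) && halts_by w n || (m == 0%N) && ~~ halts_by b n.

Lemma jump_query_sound n m w : (forall b, jump_query b n m w) -> m = zero_jump n.
Proof.
rewrite /jump_query => h; case: (eqVneq m 1%N) => [m1|m1].
  move: h; rewrite m1 /= => /(_ 0%N); rewrite orbF => h.
  by rewrite (_ : zero_jump n = true) //; apply/zero_jumpP; exists w.
have m0 : m = 0%N by have := h 0%N; rewrite (negbTE m1) => /andP[/eqP].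
rewrite m0 (_ : zero_jump n = false) //; apply/negP => /zero_jumpP[b hb].
by have := h b; rewrite m0 hb.
Qed.

Lemma jump_query_complete n : exists w, forall b, jump_query b n (zero_jump n) w.
Proof.
rewrite /jump_query; case: (boolP (zero_jump n)) => [/zero_jumpP[w h]|h].
  by exists w => b; rewrite h.
exists 0%N => b /=; apply: contra h => hb; apply/zero_jumpP; by exists b.
Qed.

Definition jump_check c z := valid (jump_query (sndn (sndn z))) (fstn (sndn z)) &&
  ex_entry (fstn (sndn z)) (fun y => [&& e_code y == encode c, e_in y == fstn z & 0 < e_out y]%N).

Lemma jump_checkP c x : (exists m, Defs.eval zero_jump c x m) <->
  exists a, forall b, jump_check c (pairn x (pairn a b)).
Proof.
rewrite /jump_check; split=> [[m h]|[a h]].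
  have [s g hs] := certified_eval jump_query_complete h.
  exists (cert s) => b; rewrite !pairnE (g b) /=.
  by apply: (ex_entry_mono (fun j => ex_intro _ j erefl) _ hs) => y /and3P[-> -> /eqP ->].
have /andP[_] := h 0%N; rewrite !pairnE => /ex_entryP[i /and3P[/eqP h1 /eqP h2 h3]].
have [|c' c1 c2] := valid_sound jump_query_sound (d := a) _ i.
  by move=> b; have := h b; rewrite !pairnE => /andP[].
exists (e_out (entry a i)).-1; rewrite -h2.
by move: c1; rewrite h1 => /encode_inj ->; exact: c2.
Qed.

Lemma tf_halts_by A w e : turing_fun w A -> turing_fun e A ->
  turing_fun (fun n => nat_of_bool (halts_by (w n) (e n))) A.
Proof.
move=> hw he; rewrite /halts_by; apply: tf_andb.
  by apply: (@tf_valid A (fun _ _ m _ => m == 0%N) (fun=> 0%N)) => //; tf.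
by rewrite /e_code /e_in /e_out; tf2; apply: (tf_comp he); tf.
Qed.

Lemma tf_jump_check A c : turing_fun (fun z => nat_of_bool (jump_check c z)) A.
Proof.
rewrite /jump_check; apply: tf_andb.
  apply: (@tf_valid A jump_query); rewrite /jump_query; tf; apply: tf_halts_by; tf.
by rewrite /e_code /e_in /e_out; tf2.
Qed.

(** Decidability of [r] is stated for every oracle because it is used twice: relative to a point
    [Y], to search for counterexamples, and relative to [Z], to enumerate an open class. *)
Lemma ce_in_zero_jump_Sigma2 W : ce_in zero_jump W -> exists2 r : nat -> bool,
  (forall A, turing_fun (fun n => nat_of_bool (r n)) A) &
  forall x, W x <-> exists a, forall b, r (pairn x (pairn a b)).
Proof.
move=> [c ->]; exists (jump_check c) => [A|x]; first exact: tf_jump_check.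
exact: jump_checkP.
Qed.

(** * Strings and scanning *)

Definition behead_code x := (x.-1)./2.

Definition bit x j := (0 < iter j behead_code x)%N && odd (iter j behead_code x).-1.

(** Counts the nonempty suffixes; [x] is a safe number of rounds, since a string is no longer than
    its code. *)
Definition len x := iteri x (fun j r => (r + (0 < iter j behead_code x))%N) 0%N.

Definition str x := mkseq (bit x) (len x).

Lemma iter_behead_code s j : iter j behead_code (string_code s) = string_code (drop j s).
Proof.
elim: j s => [|j IH] s; first by rewrite drop0.
rewrite iterSr; case: s => [|b s] /=; first by rewrite (IH [::]).
by rewrite /behead_code /= half_bit_double IH.
Qed.

Lemma string_code_gt0 s : (0 < string_code s)%N = (0 < size s)%N.
Proof. by case: s. Qed.

Lemma size_le_string_code s : (size s <= string_code s)%N.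
Proof. by elim: s => //= b s IH; rewrite -addnn; lia. Qed.

Lemma bit_string_code s j : bit (string_code s) j = nth false s j.
Proof.
rewrite /bit iter_behead_code -[in RHS](addn0 j) -nth_drop.
by case: (drop j s) => [|b s'] //=; rewrite oddD odd_double addbF oddb.
Qed.

Lemma len_string_code s : len (string_code s) = size s.
Proof.
rewrite /len; suff h k : iteri k (fun j r =>
    (r + (0 < iter j behead_code (string_code s)))%N) 0%N = minn k (size s).
  by rewrite h; apply/minn_idPr; exact: size_le_string_code.
by elim: k => [|k IH] /=; rewrite ?min0n // IH iter_behead_code string_code_gt0 size_drop; lia.
Qed.

Lemma string_codeK : cancel string_code str.
Proof.
move=> s; rewrite /str len_string_code; apply: (@eq_from_nth _ false); rewrite size_mkseq //.
by move=> i il; rewrite nth_mkseq // bit_string_code.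
Qed.

Lemma string_code_surj x : exists s, string_code s = x.
Proof.
elim/ltn_ind: x => -[|x] IH; first by exists [::].
have [s hs] : exists s, string_code s = x./2 by apply: IH; lia.
by exists (odd x :: s); rewrite /= hs odd_double_half.
Qed.

Lemma strK : cancel str string_code.
Proof. by move=> x; have [s <-] := string_code_surj x; rewrite string_codeK. Qed.

Lemma size_str x : size (str x) = len x.
Proof. by rewrite size_mkseq. Qed.

Lemma len_le x : (len x <= x)%N.
Proof. by have [s <-] := string_code_surj x; rewrite len_string_code size_le_string_code. Qed.

Section string_closure.
Variable A : nat -> bool.

Lemma tf_behead_code : turing_fun behead_code A.
Proof. by rewrite /behead_code; tf. Qed.

Lemma tf_bit f k : turing_fun f A -> turing_fun k A ->
  turing_fun (fun n => nat_of_bool (bit (f n) (k n))) A.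
Proof. by move=> hf hk; rewrite /bit; tf; exact: tf_behead_code. Qed.

Lemma tf_len f : turing_fun f A -> turing_fun (fun n => len (f n)) A.
Proof.
by move=> hf; rewrite /len; tf; [exact: tf_behead_code|apply: (tf_comp hf); tf].
Qed.

Lemma tf_string_code (B : nat -> nat -> bool) k :
  turing_fun (fun z => nat_of_bool (B (fstn z) (sndn z))) A -> turing_fun k A ->
  turing_fun (fun n => string_code (mkseq (B n) (k n))) A.
Proof.
move=> hB hk.
(* The first bit is outermost in [string_code], so the code is built from the last bit backwards. *)
apply: (@tf_ext A (fun n => iteri (k n) (fun i r => (B n (k n - i.+1) + r.*2).+1) 0%N)).
  apply: (@tf_iteri A (fun=> 0%N) (fun n i r => (B n (k n - i.+1) + r.*2).+1)) => //.
    by tf.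
  tf; apply: (@tf_comp2 A (fun a b => nat_of_bool (B a b))) => //; tf.
  by apply: (tf_comp hk); tf.
move=> n; suff h i : (i <= k n)%N ->
    iteri i (fun i r => (B n (k n - i.+1) + r.*2).+1) 0%N =
    string_code (mkseq (fun j => B n (k n - i + j)%N) i).
  by rewrite h //; congr string_code; apply: eq_mkseq => j; rewrite subnn.
elim: i => [//|i IH] ik; rewrite [LHS]/= IH 1?ltnW //.
rewrite {2}/mkseq /= addn0 (iotaDl 1 0) -map_comp.
congr (_ + _.*2).+1; congr string_code; apply: eq_map => j /=.
by congr (B n _); lia.
Qed.

End string_closure.

(** * Tails of sequences and the counting of successive hits *)

Definition shiftb p (X : nat -> bool) := fun j => X (p + j)%N.

Definition agree t (X Y : nat -> bool) := forall j, (j < t)%N -> X j = Y j.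

Lemma agreeP t X Y : agree t X Y <-> mkseq X t = mkseq Y t.
Proof.
split=> [h|h j jt].
  by apply: (@eq_from_nth _ false); rewrite !size_mkseq // => j jt; rewrite !nth_mkseq // h.
by rewrite -(nth_mkseq false X jt) h nth_mkseq.
Qed.

Lemma agree_le t t' X Y : (t' <= t)%N -> agree t X Y -> agree t' X Y.
Proof. by move=> le h j jt; apply: h; exact: leq_trans le. Qed.

Lemma shift0 X : shiftb 0 X = X. Proof. by []. Qed.

Lemma shiftD p q X : shiftb p (shiftb q X) = shiftb (q + p) X.
Proof. by apply/funext => j; rewrite /shiftb addnA. Qed.

Section scan.
Variable P : (nat -> bool) -> nat -> bool.

(* The state after [t] bits is <number of hits, position of the last hit>: each
   time [P] holds of the segment read since the last hit, a new hit is counted. *)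
Definition scan X t := iteri t (fun t st =>
  if P (shiftb (sndn st) X) (t.+1 - sndn st) then pairn (fstn st).+1 t.+1 else st) 0%N.

Definition hits X t := fstn (scan X t).

Lemma scanS X t : scan X t.+1 = if P (shiftb (sndn (scan X t)) X) (t.+1 - sndn (scan X t))
  then pairn (hits X t).+1 t.+1 else scan X t.
Proof. by []. Qed.

Lemma scan_le X t : (sndn (scan X t) <= t)%N.
Proof.
elim: t => [|t IH]; first by rewrite projn0.2.
by rewrite scanS; case: ifP => _; rewrite ?pairnE // leqW.
Qed.

Lemma hits_le X t t' : (t <= t')%N -> (hits X t <= hits X t')%N.
Proof.
elim: t' => [|t' IH]; first by rewrite leqn0 => /eqP ->.
rewrite leq_eqVlt => /orP[/eqP -> //|/IH h]; apply: leq_trans h _.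
by rewrite /hits scanS; case: ifP => _; rewrite ?pairnE.
Qed.

(** [scan] never tests a segment of length 0; this keeps [first_hit] in accord with it. *)
Hypothesis P0 : forall X, P X 0 = false.
Hypothesis Pagree : forall t X Y, agree t X Y -> P X t = P Y t.

Lemma scan_agree t X Y : agree t X Y -> scan X t = scan Y t.
Proof.
elim: t => [//|t IH] h; rewrite !scanS /hits -IH; last exact: agree_le h.
rewrite (@Pagree _ _ (shiftb (sndn (scan X t)) Y)) // => j jt; apply: h.
by have := scan_le X t; lia.
Qed.

Definition first_hit X t := P X t && all (fun i => ~~ P X i) (iota 0 t).

Lemma first_hit_ex X t : P X t -> exists2 t0, first_hit X t0 & (t0 <= t)%N.
Proof.
move=> h; have e : exists t, P X t by exists t.
case: (ex_minnP e) => t0 h0 m; exists t0; last exact: m.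
rewrite /first_hit h0; apply/allP => i; rewrite mem_iota /= add0n ltnNge.
by apply: contra => /m.
Qed.

Lemma first_hit_min X t i : first_hit X t -> (i < t)%N -> P X i = false.
Proof. by move=> /andP[_ /allP h] it; apply/negbTE/h; rewrite mem_iota. Qed.

Lemma first_hit_gt0 X t : first_hit X t -> (0 < t)%N.
Proof. by case: t => // /andP[]; rewrite P0. Qed.

Lemma first_hit_uniq X t t' : first_hit X t -> first_hit X t' -> t = t'.
Proof.
move=> h h'; case: (ltngtP t t') => // lt.
  by case/andP: h; rewrite (first_hit_min h' lt).
by case/andP: h'; rewrite (first_hit_min h lt).
Qed.

Lemma first_hit_agree X Y t : agree t X Y -> first_hit X t = first_hit Y t.
Proof.
move=> h; rewrite /first_hit (Pagree h); congr andb; apply: eq_in_all => i.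
by rewrite mem_iota /= add0n => /ltnW it; rewrite (Pagree (agree_le it h)).
Qed.

Lemma scan_before X t : (forall i, (i <= t)%N -> P X i = false) -> scan X t = 0%N.
Proof.
elim: t => [//|t IH] h.
rewrite scanS IH; last by move=> i it; apply: h; exact: leqW.
by rewrite projn0.2 subn0 shift0 h.
Qed.

Lemma scan_first X t : first_hit X t -> scan X t = pairn 1 t.
Proof.
move=> h; have := first_hit_gt0 h; case: t h => // t h _.
rewrite scanS /hits (@scan_before X t) => [|i it]; last exact: first_hit_min h _.
by rewrite projn0.2 subn0 projn0.1 shift0; case/andP: h => ->.
Qed.

(** Renewal: from the first hit on, the state is that of a fresh scan of the tail, with one hit
    added and positions translated by [t0]. *)
Lemma scan_after X t0 t : first_hit X t0 ->
  scan X (t0 + t) = pairn (hits (shiftb t0 X) t).+1 (t0 + sndn (scan (shiftb t0 X) t)).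
Proof.
move=> h; elim: t => [|t IH].
  by rewrite addn0 scan_first // /hits /scan /= projn0.1 projn0.2 addn0.
rewrite addnS scanS /hits IH !pairnE scanS shiftD.
rewrite (_ : (_.+1 - _ = t.+1 - sndn (scan (shiftb t0 X) t))%N); last by lia.
by case: ifP => _; rewrite ?pairnE // addnS.
Qed.

Lemma hits_after X t0 t k : first_hit X t0 -> (k < hits X t)%N ->
  exists t', (k <= hits (shiftb t0 X) t')%N.
Proof.
move=> h0 h; exists t; rewrite -ltnS; apply: leq_trans h _.
apply: (@leq_trans (hits X (t0 + t))); first by apply: hits_le; lia.
by rewrite {1}/hits scan_after // pairnE.
Qed.

Lemma hits_first X t : (0 < hits X t)%N -> exists t0, first_hit X t0.
Proof.
move=> h; case: (pselect (exists i, P X i)) => [[i /first_hit_ex[t0 h0 _]]|nP].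
  by exists t0.
move: h; rewrite /hits (@scan_before X t) ?projn0.1 // => i _.
by apply/negP => hi; apply: nP; exists i.
Qed.

Lemma hits_unbounded X : (forall p, exists t, P (shiftb p X) t) ->
  forall k, exists t, (k <= hits X t)%N.
Proof.
move=> h k; elim: k X h => [|k IH] X h; first by exists 0%N.
have [t /first_hit_ex[t0 h0 _]] := h 0%N.
have [|t' ht] := IH (shiftb t0 X).
  by move=> p; have [i hi] := h (t0 + p)%N; exists i; rewrite shiftD.
by exists (t0 + t')%N; rewrite {1}/hits scan_after // pairnE.
Qed.

(** [P] takes a sequence as argument, so its computability is expressed by substitution of families
    of sequences decidable in [A]. *)
Lemma tf_hits A (B : nat -> nat -> bool) k :
  (forall (B : nat -> nat -> bool) k, turing_fun (fun z => nat_of_bool (B (fstn z) (sndn z))) A ->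
    turing_fun k A -> turing_fun (fun n => nat_of_bool (P (B n) (k n))) A) ->
  turing_fun (fun z => nat_of_bool (B (fstn z) (sndn z))) A -> turing_fun k A ->
  turing_fun (fun n => hits (B n) (k n)) A.
Proof.
move=> PT hB hk; rewrite /hits; apply: tf_fstn; apply: (@tf_iteri A (fun=> 0%N) (fun n t st =>
  if P (shiftb (sndn st) (B n)) (t.+1 - sndn st) then pairn (fstn st).+1 t.+1 else st)) => //.
  by tf.
tf; apply: (PT (fun z => shiftb (sndn (sndn (sndn z))) (B (fstn z)))); rewrite /shiftb; tf.
by apply: (@tf_comp2 A (fun a b => nat_of_bool (B a b))) => //; tf.
Qed.

End scan.

(** Minimization over a dummy variable: it stops at once if [P n] holds and runs forever
    otherwise. *)
Lemma ce_dec A (P : nat -> bool) :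
  turing_fun (fun n => nat_of_bool (P n)) A -> ce_in A (fun n => P n).
Proof.
move=> hP; have [c hc] : turing_fun (fun n => nat_of_bool (~~ P (fstn n))) A.
  by apply: tf_negb; apply: (tf_comp hP); tf.
exists (Mu c); apply/seteqP; split=> n /=.
  by move=> Pn; exists 0%N; split=> //; have := hc (pairn n 0%N); rewrite pairnE Pn.
by move=> [m [h _]]; have := eval_fun h (hc (pairn n m)); rewrite pairnE; case: (P n).
Qed.

(** * The fair coin measure *)

Local Open Scope classical_set_scope.
Local Open Scope ring_scope.

Lemma measurable_cylinder s : measurable (cylinder s : set cantor).
Proof. by apply: sub_sigma_algebra; exists s. Qed.

Lemma agree_str_cylinder X t : cylinder (mkseq X t) X.
Proof. by rewrite /cylinder /= size_mkseq. Qed.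

Lemma cylinder_agree s X : cylinder s X <-> agree (size s) (nth false s) X.
Proof.
rewrite /cylinder /=; split=> [<- j|/agreeP <-].
  by rewrite size_mkseq => js; rewrite nth_mkseq.
by rewrite mkseq_nth.
Qed.

Lemma measurable_agree (P : set (nat -> bool)) t :
  (forall X Y, agree t X Y -> P X -> P Y) -> measurable (P : set cantor).
Proof.
move=> h; rewrite (_ : P =
  \bigcup_(x in [set x | P (nth false (str x)) /\ len x = t]) cylinder (str x)).
  by apply: bigcup_measurable => x _; exact: measurable_cylinder.
apply/seteqP; split=> X /=.
  move=> PX; exists (string_code (mkseq X t)); rewrite /= string_codeK.
    rewrite len_string_code size_mkseq; split=> //.
    by apply: h PX => j jt; rewrite nth_mkseq.
  exact: agree_str_cylinder.
by move=> [x /= [Px xt] /cylinder_agree]; rewrite size_str xt => a; exact: h Px.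
Qed.

Lemma measurable_agrees (P : nat -> set (nat -> bool)) (b : nat -> nat) :
  (forall t X Y, agree (b t) X Y -> P t X -> P t Y) ->
  measurable ([set X | exists t, P t X] : set cantor).
Proof.
move=> h; rewrite (_ : [set X | _] = \bigcup_t P t).
  by apply: bigcup_measurable => t _; apply: measurable_agree; exact: h.
by apply/seteqP; split=> X /= [t]; [exists t|move=> _; exists t].
Qed.

(** * Prepending finite strings *)

Definition scons (b : bool) (Y : cantor) : cantor := fun j => if j is j'.+1 then Y j' else b.

Definition catb s (Y : cantor) : cantor := fun j =>
  if (j < size s)%N then nth false s j else Y (j - size s)%N.

Lemma catb_nil Y : catb [::] Y = Y.
Proof. by apply/funext => j; rewrite /catb /= subn0. Qed.

Lemma catb_cons b s Y : catb (b :: s) Y = scons b (catb s Y).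
Proof. by apply/funext => -[|j]. Qed.

Lemma shift_catb s Y : shiftb (size s) (catb s Y) = Y.
Proof. by apply/funext => j; rewrite /shiftb /catb ltnNge leq_addr /= addKn. Qed.

Lemma catb_shift s X : cylinder s X -> catb s (shiftb (size s) X) = X.
Proof.
move=> /cylinder_agree h; apply/funext => j; rewrite /catb.
by case: ifP => [/h //|/negbT]; rewrite -leqNgt /shiftb => /subnKC ->.
Qed.

Lemma cylinder_cons b s Y : cylinder (b :: s) Y <-> Y 0%N = b /\ cylinder s (shiftb 1 Y).
Proof.
rewrite /cylinder /= /mkseq /= (iotaDl 1 0) -map_comp; split.
  by move=> [].
by move=> [-> ->].
Qed.

Lemma preimage_scons_cylinder b s : scons b @^-1` cylinder s =
  if s is b' :: s' then if b == b' then cylinder s' else set0 else setT.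
Proof.
apply/seteqP; case: s => [|b' s'].
  by split=> // Y _; rewrite /preimage /cylinder.
split=> Y; rewrite /preimage /=.
  by move=> /cylinder_cons[/= ->]; rewrite eqxx.
by case: eqP => // -> h; apply/cylinder_cons.
Qed.

Lemma measurable_scons b : measurable_fun [set: cantor] (scons b).
Proof.
apply: (@measurability _ _ _ _ [set: cantor] (scons b) (range cylinder)) => //.
move=> _ [_ [s _ <-] <-]; rewrite setTI preimage_scons_cylinder.
case: s => [|b' s]; first exact: measurableT.
by case: ifP => // _; exact: measurable_cylinder.
Qed.

HB.instance Definition _ b := isMeasurableFun.Build _ _ _ _ (scons b) (measurable_scons b).

Lemma measurable_catb s : measurable_fun [set: cantor] (catb s).
Proof.
elim: s => [|b s IH].
  by rewrite (_ : catb [::] = id) //; apply/funext => Y; rewrite catb_nil.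
rewrite (_ : catb (b :: s) = scons b \o catb s); last by apply/funext => Y; rewrite catb_cons.
by apply: measurableT_comp => //; exact: measurable_scons.
Qed.

Section fair_coin_theory.
Variable R : realType.
Local Notation mu := (fair_coin R).

(** Two cylinders are nested or disjoint, so adding the empty set gives a generating family closed
    under intersection. *)
Definition cyl0 : set (set cantor) := [set U | U = set0 \/ range cylinder U].

Lemma cyl0_sigma : @measurable _ cantor = <<s cyl0 >>.
Proof.
apply/seteqP; split=> U.
  by apply: sub_sigma_algebra2 => V h; right.
apply: smallest_sub => [|V [->|]]; first exact: sigma_algebra_measurable.
  exact: measurable0.
exact: sub_sigma_algebra.
Qed.

Lemma cyl0_setI : setI_closed cyl0.
Proof.
move=> A B [->|[s _ <-]]; first by move=> _; left; rewrite set0I.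
move=> [->|[t _ <-]]; first by left; rewrite setI0.
wlog st : s t / (size s <= size t)%N.
  by move=> h; case: (leqP (size s) (size t)) => [|/ltnW] /h // ; rewrite setIC.
case: (pselect (agree (size s) (nth false s) (nth false t))) => h.
  right; exists t => //; apply/seteqP; split=> X; last by case.
  move=> tX; split=> //; apply/cylinder_agree => j js; rewrite h //.
  by move/cylinder_agree: tX; apply; exact: leq_trans st.
left; apply/seteqP; split=> X // [/cylinder_agree sX /cylinder_agree tX].
by apply: h => j js; rewrite sX // tX //; exact: leq_trans st.
Qed.

(** Both sides are finite measures in [U], a restriction and a scaled image measure; they agree on
    cylinders and hence everywhere. *)
Lemma fair_coin_scons b (U : set cantor) : measurable U ->
  (mu (U `&` cylinder [:: b]) = (2^-1)%:E * mu (scons b @^-1` U))%E.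
Proof.
move=> mU.
have h2 : (0 : R) <= 2^-1 by rewrite invr_ge0.
pose m1 : {measure set cantor -> \bar R} := mrestr mu (measurable_cylinder [:: b]).
pose m2 : {measure set cantor -> \bar R} := mscale (NngNum h2) (distribution mu (scons b)).
apply: (@measure_unique _ R cantor cyl0 (fun=> setT) _ _ _ _ m1 m2) => //.
- exact: cyl0_sigma.
- exact: cyl0_setI.
- by move=> _; right; exists [::] => //; apply/seteqP; split.
- by rewrite bigcup_const //; exists 0%N.
- move=> A [->|[s _ <-]]; first by rewrite !measure0.
  change (mu (cylinder s `&` cylinder [:: b]) = (2^-1)%:E * mu (scons b @^-1` cylinder s))%E.
  rewrite preimage_scons_cylinder; case: s => [|b' s].
    rewrite (_ : cylinder [::] = setT); last by apply/seteqP; split.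
    by rewrite setTI fair_coin_cylinder probability_setT mule1 expr1.
  case: eqP => [<-|bb].
    rewrite (_ : _ `&` _ = cylinder (b :: s)).
      by rewrite !fair_coin_cylinder exprS EFinM.
    apply/seteqP; split=> Y; first by case.
    by move=> h; split => //; move/cylinder_cons: h => [h _]; apply/cylinder_cons.
  rewrite (_ : _ `&` _ = set0) ?measure0 ?mule0 //.
  apply/seteqP; split=> Y // [/cylinder_cons[h _] /cylinder_cons[h' _]].
  by apply: bb; rewrite -h -h'.
- move=> _; change (mu ([set: cantor] `&` cylinder [:: b]) < +oo)%E.
  by rewrite setTI fair_coin_cylinder ltry.
Qed.

Lemma fair_coin_catb s (U : set cantor) : measurable U ->
  (mu (U `&` cylinder s) = (2^-1 ^+ size s)%:E * mu (catb s @^-1` U))%E.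
Proof.
elim: s U => [|b s IH] U mU.
  rewrite expr0 mul1e (_ : cylinder [::] = setT) ?setIT; last by apply/seteqP; split.
  by rewrite (_ : catb [::] = id) //; apply/funext => Y; rewrite catb_nil.
have mS : measurable (scons b @^-1` U).
  by rewrite -[X in measurable X]setTI; exact: measurable_scons.
transitivity (mu (U `&` cylinder (b :: s) `&` cylinder [:: b])).
  congr (mu _); apply/seteqP; split=> Y [h1 h2]; last by case: h1.
  by split=> //; move/cylinder_cons: h2 => [h _]; apply/cylinder_cons.
rewrite fair_coin_scons; last by apply: measurableI => //; exact: measurable_cylinder.
rewrite preimage_setI [X in (_ `&` X)]preimage_scons_cylinder eqxx IH //.
rewrite muleA -EFinM -exprS; congr (_ * mu _)%E.
by apply/seteqP; split=> Y; rewrite /preimage /= catb_cons.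
Qed.

Lemma fair_coin_catb_le s (U : set cantor) : measurable U ->
  (mu (catb s @^-1` U) <= (2 ^+ size s)%:E * mu U)%E.
Proof.
move=> mU; have -> : (mu (catb s @^-1` U) = (2 ^+ size s)%:E * mu (U `&` cylinder s))%E.
  by rewrite fair_coin_catb // muleA -EFinM -exprMn mulfV // expr1n mul1e.
apply: lee_wpmul2l; first by rewrite lee_fin exprn_ge0.
apply: le_measure; rewrite ?inE //.
by apply: measurableI => //; exact: measurable_cylinder.
Qed.

End fair_coin_theory.

(** * Tails of random points *)

Section kucera.
Variables (R : realType) (P : (nat -> bool) -> nat -> bool).
Local Notation mu := (fair_coin R).
Hypothesis P0 : forall X, P X 0 = false.
Hypothesis Pagree : forall t X Y, agree t X Y -> P X t = P Y t.

Definition hit_set : set cantor := [set X | exists t, P X t].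

Definition hits_set k : set cantor := [set X | exists t, (k <= hits P X t)%N].

Definition hit_strings : set nat := [set x | first_hit P (nth false (str x)) (len x)].

Lemma measurable_hit_set : measurable hit_set.
Proof. by apply: (@measurable_agrees _ id) => t X Y /Pagree ->. Qed.

Lemma measurable_shift_hits p k : measurable (shiftb p @^-1` hits_set k : set cantor).
Proof.
apply: (@measurable_agrees (fun t X => (k <= hits P (shiftb p X) t)%N) (fun t => (p + t)%N)).
move=> t X Y h; rewrite /hits (@scan_agree P Pagree t _ (shiftb p Y)) // => j jt.
by apply: h; rewrite ltn_add2l.
Qed.

Lemma measurable_hits_set k : measurable (hits_set k).
Proof. exact: (measurable_shift_hits 0). Qed.

Lemma cylinder_first_hit x X : hit_strings x -> cylinder (str x) X -> first_hit P X (len x).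
Proof.
by move=> h /cylinder_agree; rewrite size_str => /(first_hit_agree Pagree) <-.
Qed.

Lemma first_hit_string X t : first_hit P X t ->
  exists2 x, hit_strings x & len x = t /\ cylinder (str x) X.
Proof.
move=> h; exists (string_code (mkseq X t));
  rewrite ?/hit_strings /= string_codeK len_string_code size_mkseq.
  by rewrite -(@first_hit_agree P Pagree X) // => j jt; rewrite nth_mkseq.
by split=> //; exact: agree_str_cylinder.
Qed.

Lemma trivIset_hit_strings : trivIset hit_strings (fun x => cylinder (str x)).
Proof.
move=> x y hx hy [X [Xx Xy]]; rewrite -(strK x) -(strK y).
have := first_hit_uniq (cylinder_first_hit hx Xx) (cylinder_first_hit hy Xy).
by move: Xx Xy; rewrite /cylinder /= !size_str => <- <- ->.
Qed.

Lemma hit_setE : hit_set = \bigcup_(x in hit_strings) cylinder (str x).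
Proof.
apply/seteqP; split=> X.
  move=> [t /first_hit_ex[t0 h _]]; have [x hx [_ Xx]] := first_hit_string h; by exists x.
by move=> [x hx /(cylinder_first_hit hx)/andP[h _]]; exists (len x).
Qed.

(** Split according to the string read up to the first hit. Inside its cylinder the rest of the
    sequence is again a fair coin and must make [k] further hits; the measures of these disjoint
    cylinders add up to that of [hit_set]. *)
Lemma fair_coin_hits_setS k : (mu (hits_set k.+1) <= mu hit_set * mu (hits_set k))%E.
Proof.
have mE x : measurable ((shiftb (len x) @^-1` hits_set k) `&` cylinder (str x) : set cantor).
  by apply: measurableI; [exact: measurable_shift_hits|exact: measurable_cylinder].
apply: (@le_trans _ _ (mu (\bigcup_(x in hit_strings)
    ((shiftb (len x) @^-1` hits_set k) `&` cylinder (str x))))).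
  apply: le_measure; rewrite ?inE; first exact: measurable_hits_set.
    by apply: bigcup_measurable => x _; exact: mE.
  move=> X [t ht]; have [t0 h0] : exists t0, first_hit P X t0.
    by apply: (@hits_first P X t); apply: leq_trans ht.
  have [x hx [xt Xx]] := first_hit_string h0.
  by exists x => //; split=> //; rewrite xt; exact: hits_after ht.
rewrite measure_bigcup; last 2 first.
- by move=> x _; exact: mE.
- move=> x y hx hy [X [[_ Xx] [_ Xy]]]; apply: trivIset_hit_strings => //.
  by exists X.
rewrite hit_setE measure_bigcup; last 2 first.
- by move=> x _; exact: measurable_cylinder.
- exact: trivIset_hit_strings.
have fG : mu (hits_set k) \is a fin_num by apply: fin_num_measure; exact: measurable_hits_set.
rewrite -(fineK fG) muleC -nneseriesZl; last by move=> *; exact: measure_ge0.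
rewrite le_eqVlt; apply/orP; left; apply/eqP; apply: eq_eseriesr => x _.
rewrite [LHS]fair_coin_catb; last exact: measurable_shift_hits.
rewrite fineK // [LHS]muleC [X in _ = (_ * X)%E]fair_coin_cylinder; congr (mu _ * _)%E.
by apply/seteqP; split=> X; rewrite /preimage /= -size_str shift_catb.
Qed.

Lemma fair_coin_hits_set k : (mu (hits_set k) <= (fine (mu hit_set) ^+ k)%:E)%E.
Proof.
have fO : mu hit_set \is a fin_num by apply: fin_num_measure; exact: measurable_hit_set.
elim: k => [|k IH].
  by rewrite expr0; apply: probability_le1; exact: measurable_hits_set.
apply: le_trans (fair_coin_hits_setS k) _.
by rewrite exprS EFinM fineK //; apply: lee_wpmul2l.
Qed.

(* Kucera: the cylinders of first hits are prefix free, so having [k] hits in a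
   row is an event of measure at most [mu hit_set ^+ k]; a point none of whose
   tails escapes [hit_set] is captured by all of these. *)
Lemma random_tail (Z X : nat -> bool) :
  (forall (B : nat -> nat -> bool) k, turing_fun (fun z => nat_of_bool (B (fstn z) (sndn z))) Z ->
    turing_fun k Z -> turing_fun (fun n => nat_of_bool (P (B n) (k n))) Z) ->
  (mu hit_set < 1)%E -> random_in R Z X -> exists p, ~ hit_set (shiftb p X).
Proof.
move=> PT q1 rX; apply: contrapT => nX.
have hX p : hit_set (shiftb p X) by apply: contrapT => h; apply: nX; exists p.
set q := fine (mu hit_set).
have fO : mu hit_set \is a fin_num by apply: fin_num_measure; exact: measurable_hit_set.
have q_ge0 : 0 <= q by apply: fine_ge0; exact: measure_ge0.
have q_lt1 : q < 1 by rewrite -lte_fin /q fineK.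
(* The test needs the bounds [2 ^ -n] while [q] is only below 1, so [j] hits are spent on each
   factor 1/2. *)
have [j qj] : exists j, q ^+ j <= 2^-1.
  have nq : `|q| < 1 by rewrite ger0_norm.
  have /cvgrPdist_le/(_ 2^-1) := cvg_expr nq.
  case=> [|j _ /(_ j (leqnn _))]; first by rewrite invr_gt0.
  by rewrite /= sub0r normrN ger0_norm ?exprn_ge0 // => h; exists j.
apply: (rX (fun n => hits_set (j * n))).
  split; last first.
    move=> n; apply: le_trans (fair_coin_hits_set _) _.
    by rewrite lee_fin exprM lerXn2r // nnegrE ?exprn_ge0 ?invr_ge0.
  exists (fun z => j * fstn z <= hits P (bit (sndn z)) (len (sndn z)))%N.
    apply: ce_dec; tf; apply: (@tf_hits P Z (fun z => bit (sndn z))) => //.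
      by apply: tf_bit; tf.
    by apply: tf_len; tf.
  move=> n; apply/seteqP; split=> Y.
    move=> [t ht]; exists (mkseq Y t); last exact: agree_str_cylinder.
    rewrite /= !pairnE len_string_code size_mkseq.
    rewrite /hits (@scan_agree P Pagree t _ Y) // => i it.
    by rewrite bit_string_code nth_mkseq.
  move=> [s /= hs /cylinder_agree sY]; exists (size s); move: hs.
  rewrite !pairnE len_string_code /hits (@scan_agree P Pagree (size s) _ Y) // => i it.
  by rewrite bit_string_code sY.
by move=> n _; exact: hits_unbounded.
Qed.

End kucera.

(** * Domination *)

Section sigma2_class.
Variable r : nat -> bool.
Hypothesis rT : forall A, turing_fun (fun n => nat_of_bool (r n)) A.

(* Here [n] is <x, <i, a>>; with [r] a [Sigma_2] definition of the test, the
   condition [forall b, bad Y n b] says that [a] witnesses the enumeration of the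
   first [i] bits of [str x ++ Y] into the component [2 * x + 2]. *)
Definition bad (Y : nat -> bool) n b :=
  r (pairn (pairn (fstn n).*2.+2 (string_code (mkseq (catb (str (fstn n)) Y) (fstn (sndn n)))))
           (pairn (sndn (sndn n)) b)).

Definition bad_set : set cantor := [set Y | exists n, forall b, bad Y n b].

(** The stage [q] bounds [n] and thereby the number of bits of [Y] that are read, since [bad Y n]
    looks at no more than the first [n]. Stage 0 finds nothing, as the scan demands. *)
Definition bad_upto (h : nat -> nat) (Y : nat -> bool) q :=
  has (fun n => all (bad Y n) (iota 0 (h n))) (iota 0 q).

Lemma bad_agree n X Y : agree n X Y -> bad X n = bad Y n.
Proof.
move=> h; apply/funext => b; rewrite /bad; congr (r (pairn (pairn _ (string_code _)) _)).
apply/agreeP => j ji; rewrite /catb; case: ifP => // _; apply: h.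
by apply: leq_ltn_trans (leq_subr _ _) (leq_trans ji _); apply: leq_trans (fstn_le _) (sndn_le _).
Qed.

Lemma bad_upto_agree h q X Y : agree q X Y -> bad_upto h X q = bad_upto h Y q.
Proof.
move=> a; apply: eq_in_has => n; rewrite mem_iota /= add0n => nq.
by rewrite (bad_agree (agree_le (ltnW nq) a)).
Qed.

Lemma bad_uptoP h Y : hit_set (bad_upto h) Y <->
  exists n, forall b, (b < h n)%N -> bad Y n b.
Proof.
split=> [[q /hasP[n _ /allP a]]|[n a]].
  by exists n => b bh; apply: a; rewrite mem_iota.
exists n.+1; apply/hasP; exists n; first by rewrite mem_iota /= add0n.
by apply/allP => b; rewrite mem_iota; exact: a.
Qed.

Lemma measurable_bad_set : measurable bad_set.
Proof. by apply: (@measurable_agrees _ id) => t X Y /bad_agree ->. Qed.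

Lemma tf_bad A (B : nat -> nat -> bool) f g :
  turing_fun (fun z => nat_of_bool (B (fstn z) (sndn z))) A -> turing_fun f A -> turing_fun g A ->
  turing_fun (fun n => nat_of_bool (bad (B n) (f n) (g n))) A.
Proof.
move=> hB hf hg; rewrite /bad; apply: (tf_comp (rT A)); tf.
apply: (@tf_string_code A (fun n => catb (str (fstn (f n))) (B n))); tf.
apply: (@tf_ext A (fun z => nat_of_bool (if sndn z < len (fstn (f (fstn z)))
  then bit (fstn (f (fstn z))) (sndn z)
  else B (fstn z) (sndn z - len (fstn (f (fstn z)))))%N)).
  have hl : turing_fun (fun z => len (fstn (f (fstn z)))) A.
    by apply: tf_len; tf; apply: (tf_comp hf); tf.
  apply: (@tf_ext A (fun z => if (sndn z < len (fstn (f (fstn z))))%N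
   then nat_of_bool (bit (fstn (f (fstn z))) (sndn z))
   else nat_of_bool (B (fstn z) (sndn z - len (fstn (f (fstn z)))))%N)); last first.
    by move=> z; case: ifP.
  tf; first by apply: tf_bit; tf; apply: (tf_comp hf); tf.
  by apply: (@tf_comp2 A (fun a b => nat_of_bool (B a b))) => //; tf.
move=> z; rewrite /catb size_str; case: ifP => // h.
by rewrite -bit_string_code strK.
Qed.

Lemma tf_bad_upto A h (B : nat -> nat -> bool) k : turing_fun h A ->
  turing_fun (fun z => nat_of_bool (B (fstn z) (sndn z))) A -> turing_fun k A ->
  turing_fun (fun n => nat_of_bool (bad_upto h (B n) (k n))) A.
Proof.
move=> hh hB hk; rewrite /bad_upto; tf; last by apply: (tf_comp hh); tf.
apply: (@tf_bad A (fun z => B (fstn (fstn z)))); tf.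
by apply: (@tf_comp2 A (fun a b => nat_of_bool (B a b))) => //; tf.
Qed.

Lemma least_witness Y : ~ bad_set Y -> exists2 g, turing_fun g Y & forall n, ~~ bad Y n (g n).
Proof.
move=> nV; have ex n : exists b, ~~ bad Y n b.
  apply: contrapT => h; apply: nV; exists n => b; apply/negPn/negP => hb.
  by apply: h; exists b.
exists (fun n => ex_minn (ex n)); last by move=> n; case: ex_minnP.
have [c hc] : turing_fun (fun z => nat_of_bool (bad Y (fstn z) (sndn z))) Y.
  apply: (@tf_bad Y (fun _ => Y)); tf.
  by apply: tf_oracle; tf.
exists (Mu c) => n /=; case: ex_minnP => m nm min; split.
  by have := hc (pairn n m); rewrite !pairnE (negbTE nm).
move=> i im; exists 0%N; have := hc (pairn n i); rewrite !pairnE.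
by case: (boolP (bad Y n i)) => // /min; rewrite leqNgt im.
Qed.

End sigma2_class.

(** A constant absorbs the finitely many exceptions, and adding it keeps [f] computable from the
    same oracle. *)
Lemma dominates_bound f g : dominates f g -> exists k, forall n, (g n < f n + k)%N.
Proof.
move=> [m h]; exists (\sum_(i < m.+1) (g i).+1)%N => n.
case: (ltnP m n) => [/h/leq_trans->//|]; first exact: leq_addr.
move=> nm; apply: leq_trans (leq_addl _ _).
by rewrite (bigD1 (Ordinal (nm : (n < m.+1)%N))) //= leq_addr.
Qed.

Section domination.
Variables (R : realType) (Z : nat -> bool).
Local Notation mu := (fair_coin R).

(* Only countably many functions are computable from [Z], so if each of the
   closed sets [~` hit_set] below were null, so would be [~` bad_set]. *)
Lemma ae_dominating_positive r : ae_dominating R Z ->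
  (forall A, turing_fun (fun n => nat_of_bool (r n)) A) -> (mu (bad_set r) < 1)%E ->
  exists2 h, turing_fun h Z & (mu (hit_set (bad_upto r h)) < 1)%E.
Proof.
move=> aeZ rT V1; apply: contrapT => none.
have mO h : measurable (hit_set (bad_upto r h)).
  by apply: measurable_hit_set; exact: bad_upto_agree.
have null h : turing_fun h Z -> mu.-negligible (~` hit_set (bad_upto r h)).
  move=> hh; apply/negligibleP; first exact: measurableC.
  rewrite [LHS](probability_setC mu (mO h)); apply/eqP.
  rewrite sube_eq ?fin_num_measure // ?add0e.
  rewrite eq_le probability_le1 // andbT leNgt.
  by apply/negP => lt; apply: none; exists h.
(* Indexing by the number of a code and by the constant that absorbs the exceptions makes this a
   countable family; it is empty when [e] indexes no total function. *)
pose F e k : set cantor := [set Y | exists c, encode c = e /\ exists f,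
  (forall n, Defs.eval Z c n (f n)) /\ ~ hit_set (bad_upto r (fun n => f n + k)%N) Y].
have nullF e k : mu.-negligible (F e k).
  case: (pselect (exists c, encode c = e /\ exists f, forall n, Defs.eval Z c n (f n))).
    move=> [c [ce [f hf]]].
    apply: (@negligibleS _ _ _ _ (~` hit_set (bad_upto r (fun n => f n + k)%N))).
      move=> Y [c' [ce' [f' [hf' hY]]]].
      suff -> : f = f' by [].
      apply/funext => n; apply: eval_fun (hf n) _.
      by move: ce'; rewrite -ce => /encode_inj <-.
    apply: null; apply: tf_add; last exact: tf_const.
    by exists c.
  move=> h; rewrite (_ : F e k = set0); first exact: negligible_set0.
  apply/seteqP; split=> Y // [c [ce [f [hf _]]]].
  by apply: h; exists c; split=> //; exists f.
have nullU : mu.-negligible (~` bad_set r).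
  (* A point outside [bad_set] is either exceptional for domination or lies in some [F e k]: there
     [h] bounds the function giving its counterexamples, so every [n] is refuted below [h n]. *)
  apply: negligibleS (negligibleU aeZ (negligible_bigcup (fun e => negligible_bigcup (nullF e)))).
  move=> Y nV; apply: contrapT => /not_orP[/contrapT dom nU]; apply: nU.
  have [g gY hg] := least_witness rT nV.
  have [f [c hc] /dominates_bound[k hk]] := dom g gY.
  exists (encode c) => //; exists k => //; exists c; split=> //; exists f; split=> //.
  by move=> /bad_uptoP[n /(_ (g n) (hk n))]; apply/negP; exact: hg.
have := (negligibleP mu (measurableC (measurable_bad_set r))).1 nullU.
rewrite [X in X = _ -> _](probability_setC mu (measurable_bad_set r)).
have fV : mu (bad_set r) \is a fin_num by apply: fin_num_measure; exact: measurable_bad_set.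
move: V1; rewrite -(fineK fV) lte_fin -EFinB => V1 [].
by move/eqP; rewrite subr_eq0 => /eqP e; move: V1; rewrite -e ltxx.
Qed.

End domination.

Lemma uniformly_Sigma01P A U : uniformly_Sigma01 A U -> exists2 W, ce_in A W &
  forall n X, U n X <-> exists i, W (pairn n (string_code (mkseq X i))).
Proof.
move=> [W cW hU]; exists W => // n X; rewrite hU; split=> [[s /= hs sX]|[i hi]].
  by exists (size s); rewrite sX.
by exists (mkseq X i) => //; exact: agree_str_cylinder.
Qed.

Lemma measurable_Sigma01 A U n : uniformly_Sigma01 A U -> measurable (U n : set cantor).
Proof.
move=> /uniformly_Sigma01P[W _ hU].
rewrite (_ : U n = [set X | exists i, W (pairn n (string_code (mkseq X i)))]).
  by apply: (@measurable_agrees _ id) => t X Y /agreeP ->.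
by apply/seteqP; split=> X /hU.
Qed.

Theorem theorem5p5 (R : realType) (Z : nat -> bool) :
  ae_dominating R Z ->
  forall X : nat -> bool, random_in R Z X -> two_random R X.
Proof.
move=> aeZ X rX U [sU mU] UX.
have [W cW hU] := uniformly_Sigma01P sU.
have [r rT hr] := ce_in_zero_jump_Sigma2 cW.
have badP Y : bad_set r Y <-> exists x, U x.*2.+2 (catb (str x) Y).
  split=> [[n h]|[x /hU[i /hr[a h]]]].
    exists (fstn n); apply/hU; exists (fstn (sndn n)); apply/hr; exists (sndn (sndn n)) => b.
    exact: h.
  by exists (pairn x (pairn i a)) => b; rewrite /bad !pairnE.
have V1 : (fair_coin R (bad_set r) < 1)%E.
  have mUx x : measurable (catb (str x) @^-1` U x.*2.+2 : set cantor).
    rewrite -[X in measurable X]setTI; apply: measurable_catb => //.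
    exact: measurable_Sigma01 sU.
  apply: (@le_lt_trans _ _ (2^-1)%:E); last by rewrite lte_fin invf_lt1 // ltr1n.
  apply: (@le_trans _ _ (\sum_(0 <= x <oo) fair_coin R (catb (str x) @^-1` U x.*2.+2))%E).
    apply: measure_sigma_subadditive => //; first exact: measurable_bad_set.
    by move=> Y /badP[x hx]; exists x.
  (* The geometric series with terms [2^-1 / 2 ^ (x + 1)]: the prefix costs at most [2 ^ x], and the
     component has measure at most [2 ^ -(2x + 2)]. *)
  apply: le_trans (epsilon_trick0 xpredT (_ : 0 <= 2^-1)); last by rewrite invr_ge0.
  apply: lee_nneseries => [x _ _|x _]; first exact: measure_ge0.
  apply: le_trans (fair_coin_catb_le _ _ _) _; first exact: measurable_Sigma01 sU.
  apply: (@le_trans _ _ ((2 ^+ x)%:E * (2^-1 ^+ x.*2.+2)%:E)%E).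
    have le_x : ((2 ^+ size (str x))%:E <= (2 ^+ x)%:E :> \bar R)%E.
      by rewrite lee_fin ler_weXn2l ?ler1n // size_str len_le.
    by apply: (lee_pmul _ _ le_x (mU _)); rewrite ?lee_fin ?exprn_ge0.
  rewrite -EFinM lee_fin (_ : x.*2.+2 = x + (x.+1 + 1))%N; last by lia.
  by rewrite exprD mulrA -exprMn mulfV // expr1n mul1r exprD expr1 mulrC natrX exprVn.
have [h hZ h1] := ae_dominating_positive aeZ rT V1.
have [||p] := random_tail _ (@bad_upto_agree r h) _ h1 rX.
- by [].
- by move=> B k; exact: tf_bad_upto.
have [n hn] : bad_set r (shiftb p X).
  (* Putting the removed prefix back in front of the tail restores [X], which lies in every
     component of the test. *)
  apply/badP; exists (string_code (mkseq X p)); rewrite string_codeK.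
  have := @catb_shift (mkseq X p) X (agree_str_cylinder X p).
  by rewrite size_mkseq => ->; exact: UX.
by apply; apply/bad_uptoP; exists n => b _; exact: hn.
Qed.
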